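(* Let $k$ be an algebraically closed field of characteristic zero and let $V$ be a finite-dimensional $k$-vector space. Suppose that a finite subgroup $G\subset \mathrm{GL}(V)$ contains no pseudo-reflections, and let $X = V/\!/G$. Then for every automorphism $\sigma$ of the variety $X$ there is an automorphism $\tau$ of the group $G$ such that $\sigma(X^{(H)}) = X^{(\tau(H))}$ for every subgroup $H$ of $G$. In particular, the Luna stratification in $X$ is intrinsic.
   Context: A pseudo-reflection is a non-trivial element $g\in\mathrm{GL}(V)$ of finite order that fixes a hyperplane of $V$ pointwise. For a reductive group $G$ acting linearly on $V$, $\pi\colon V\to X=V/\!/G=\operatorname{Spec}k[V]^G$ is the categorical quotient map. For every $p\in X$ the fiber $\pi^{-1}(p)$ contains a unique closed $G$-orbit; let $v_p$ be a point of this orbit. For a reductive subgroup $H\subset G$ with conjugacy class $(H)$, the Luna stratum is $X^{(H)}=\{p\in X : \mathrm{Stab}_G(v_p)\in (H)\}$ (possibly empty). (If $G$ is finite, all orbits are closed and all subgroups are reductive.) The Luna stratification in $X$ is called intrinsic if for every automorphism $\sigma\colon X\to X$ of the variety $X$ and every reductive subgroup $H\subset G$ there is a reductive subgroup $H'\subset G$ such that $\sigma(X^{(H)})=X^{(H')}$. *)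

(* Defs.v *)
From HB Require Import structures.
From mathcomp Require Import all_boot all_order all_algebra all_fingroup.
From mathcomp Require Import mpoly.
From mathcomp Require Import boolp classical_sets.
Set Implicit Arguments.
Unset Strict Implicit.
Unset Printing Implicit Defensive.
Import GRing.Theory.
Local Open Scope ring_scope.

Section LunaStratification.

Variables (k : fieldType) (V : vectType k) (gT : finGroupType).
Variable rho : gT -> 'End(V).

(* A finite subgroup of GL(V) is the image of a faithful linear representation
   of a finite group. Invertibility of each [rho g] follows from the two
   equations. *)
Definition faithful_repr : Prop :=
  [/\ rho 1%g = \1%VF,
      forall g h : gT, rho (g * h)%g = (rho g \o rho h)%VF
    & injective rho].

(* The condition on dimensions excludes dim V = 0, where V has no hyperplane. *)
Definition pseudo_reflection (f : 'End(V)) : Prop :=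
  [/\ lker f = 0%VS,
      f <> \1%VF,
      exists2 m : nat, (0 < m)%N & iter m f =1 id
    & exists2 U : {vspace V},
        (\dim U).+1 = \dim {:V} & (U <= fixedSpace f)%VS].

(* k[V] is the polynomial ring in the coordinates of V on a fixed basis. *)
Definition coords (v : V) : 'I_(\dim {:V}) -> k :=
  fun i => coord (vbasis {:V}) i v.

(* Over an infinite field a polynomial is invariant iff the function it defines
   on V is. *)
Definition invariant_poly : {pred {mpoly k[\dim {:V}]}} :=
  fun P =>
    `[< forall (g : gT) (v : V), P.@[coords (rho g v)] = P.@[coords v] >].

Fact invariant_poly_subalg : subalg_closed invariant_poly.
Proof.
split=> [|a P Q /asboolP hP /asboolP hQ|P Q /asboolP hP /asboolP hQ];
  apply/asboolP => g v.
- by rewrite !meval1.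
- by rewrite !mevalD !mevalZ hP hQ.
- by rewrite !mevalM hP hQ.
Qed.

HB.instance Definition _ :=
  GRing.isSubalgClosed.Build _ _ invariant_poly invariant_poly_subalg.

Record invariant_ring : Type := InvariantRing {
  invariant_val :> {mpoly k[\dim {:V}]};
  _ : invariant_val \in invariant_poly
}.

HB.instance Definition _ := [isSub for invariant_val].
HB.instance Definition _ := [Choice of invariant_ring by <:].
HB.instance Definition _ := [SubChoice_isSubAlgebra of invariant_ring by <:].
HB.instance Definition _ := [SubNzRing_isSubComNzRing of invariant_ring by <:].

(* The points of the variety X = Spec k[V]^G, as k-algebra homomorphisms
   k[V]^G -> k; for k algebraically closed these are the closed points of the
   scheme. The value of f in k[V]^G at p is [p f]. *)
Definition quot : Type := {lrmorphism invariant_ring -> k^o}.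

Definition eval_at (v : V) (f : invariant_ring) : k^o :=
  (invariant_val f).@[coords v].

Fact eval_at_linear v : linear (eval_at v).
Proof. by move=> a f g; rewrite /eval_at mevalD mevalZ. Qed.

Fact eval_at_monoid v : monoid_morphism (eval_at v).
Proof. by split=> [|f g]; rewrite /eval_at ?meval1 ?mevalM. Qed.

HB.instance Definition _ v :=
  GRing.isLinear.Build k invariant_ring k^o *:%R (eval_at v) (eval_at_linear v).
HB.instance Definition _ v :=
  GRing.isMonoidMorphism.Build invariant_ring k^o (eval_at v)
    (eval_at_monoid v).

Definition quot_map (v : V) : quot := eval_at v.

Definition stab (v : V) : {set gT} := [set g : gT | rho g v == v].

(* All orbits of a finite group are closed, so v ranges over the whole fiber
   of the quotient map over p, which is a single orbit. *)
Definition luna_stratum (H : {set gT}) : set quot :=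
  [set p | exists2 v : V,
             quot_map v = p & (stab v \in H :^: [set: gT]%SET)%g]%classic.

(* X is affine with coordinate ring k[V]^G: a map X -> X is a morphism of
   varieties iff it pulls regular functions back to regular functions. *)
Definition quot_morphism (sigma : quot -> quot) : Prop :=
  forall f : invariant_ring, exists h : invariant_ring,
    forall p : quot, sigma p f = p h.

Definition quot_automorphism (sigma : quot -> quot) : Prop :=
  quot_morphism sigma /\
  exists sigma' : quot -> quot,
    [/\ quot_morphism sigma', cancel sigma sigma' & cancel sigma' sigma].

(* Every subgroup of a finite group is reductive. *)
Definition luna_intrinsic : Prop :=
  forall sigma : quot -> quot, quot_automorphism sigma ->
  forall H : {group gT}, exists H' : {group gT},
    (sigma @` luna_stratum H = luna_stratum H')%classic.

End LunaStratification.

Arguments luna_stratum {k V gT} rho H _.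

(* Main.v *)
(** Let A = k[V], B = A^G, and let s be the automorphism of B induced by sigma.
    Choose a field E containing A and a second copy phi(A) of A such that phi
    restricts to s on B.  As G contains no pseudo-reflections, A is unramified
    over B in codimension one, so the partial derivatives of A extend to
    derivations of E and preserve a ring C containing A and phi(A), integral
    over A: each derivative is integral after multiplication by any member of a
    family of elements of A without common factor, and A is factorial.  (This is
    purity of the branch locus, in characteristic zero.)  Extend evaluation at
    the origin to C.  Taylor expansion at the origin maps C, hence phi(A), to
    formal power series, which is a formal lift F of sigma at the origin.  Two
    lifts differ by an element of G, so F intertwines each g in G with some
    tau(g) in G.  The linear part of F is invertible, so tau is an automorphism,
    and F maps V^H into V^(tau H), whence sigma maps the image of V^H into the
    image of V^(tau H).  The same bound for the inverse of sigma forces equality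
    of stabilisers. *)

Require Import Defs.
From HB Require Import structures.
From mathcomp Require Import all_boot all_order all_algebra all_fingroup.
From mathcomp Require Import all_field ring.
From mathcomp Require Import mpoly.
From mathcomp Require Import boolp classical_sets.
Set Implicit Arguments.
Unset Strict Implicit.
Unset Printing Implicit Defensive.
Import GRing.Theory.
Local Open Scope ring_scope.

(** * Factorial domains *)

(** The absence of pseudo-reflections enters through [r_codim]: fixed spaces have codimension at
    least two, so in every direction some line misses them all, and every nonconstant polynomial has
    a zero with trivial stabiliser. At such a zero some discriminant-like [multiplier] is nonzero,
    so no prime divides all multipliers. The obstacle is that the denominators of derivatives must
    lie in A for descent to integrality over A, while those that arise from differentiating phi(A)
    lie in phi(A). Norms down to B carry them across. Working formally at the origin avoids the
    study of unramified covers of affine space. Nothing is lost: G acts linearly, lines through the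
    origin reach every point, and on invariants the lift along such a line is a polynomial in the
    parameter, which can be evaluated at 1. Whenever an element of G is found depending on a vector,
    finiteness of G and [thin] sets, a substitute for Zariski-closed sets, make the choice
    uniform. *)

Section Factorial.

Variable R : idomainType.

Definition divides (x y : R) : Prop := exists z, y = z * x.

Definition prime_elt (p : R) : Prop :=
  [/\ p != 0, p \isn't a GRing.unit
    & forall x y, divides p (x * y) -> divides p x \/ divides p y].

Definition factored (x : R) : Prop :=
  exists u (s : seq R), [/\ u \is a GRing.unit,
    (forall p, p \in s -> prime_elt p) & x = u * \prod_(p <- s) p].

Definition factorial_dom : Prop := forall x : R, x != 0 -> factored x.

Lemma divides_mull x y z : divides x y -> divides x (z * y).
Proof. by case=> w ->; exists (z * w); rewrite mulrA. Qed.

Lemma divides_mulr x y z : divides x y -> divides x (y * z).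
Proof. by rewrite mulrC; apply: divides_mull. Qed.

Lemma divides_add x y z : divides x y -> divides x z -> divides x (y + z).
Proof. by case=> a -> [b ->]; exists (a + b); rewrite mulrDl. Qed.

Lemma divides_sum (I : Type) (r : seq I) (P : pred I) (F : I -> R) x :
  (forall i, P i -> divides x (F i)) -> divides x (\sum_(i <- r | P i) F i).
Proof.
move=> xF; elim/big_rec: _ => [|i y Pi xy]; first by exists 0; rewrite mul0r.
by apply: divides_add => //; apply: xF.
Qed.

Lemma prime_divides_exp x n p : prime_elt p -> divides p (x ^+ n) -> divides p x.
Proof.
case=> _ pu pP; elim: n => [|n IH]; last by rewrite exprS => /pP[|/IH].
rewrite expr0 => -[z zE]; case/negP: pu.
by apply/unitrP; exists z; rewrite [p * z]mulrC -zE.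
Qed.

Lemma divides_unit p u : divides p u -> u \is a GRing.unit -> p \is a GRing.unit.
Proof. by case=> z ->; rewrite unitrM => /andP[]. Qed.

Lemma factored_unit u : u \is a GRing.unit -> factored u.
Proof. by move=> uu; exists u, [::]; split=> //; rewrite big_nil mulr1. Qed.

Lemma factored_prime p : prime_elt p -> factored p.
Proof.
move=> pp; exists 1, [:: p]; split; rewrite ?unitr1 ?big_seq1 ?mul1r //.
by move=> q; rewrite inE => /eqP->.
Qed.

Lemma factoredM x y : factored x -> factored y -> factored (x * y).
Proof.
case=> u [s [uu sp ->]] [v [t [vv tp ->]]]; exists (u * v), (s ++ t); split.
- by rewrite unitrM uu.
- by move=> p; rewrite mem_cat => /orP[/sp|/tp].
- by rewrite big_cat /= mulrACA.
Qed.

Lemma factored_ind (P : R -> Prop) :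
  (forall u, u \is a GRing.unit -> P u) ->
  (forall p x, prime_elt p -> x != 0 -> P x -> P (p * x)) ->
  forall x, factored x -> P x.
Proof.
move=> Pu Pp x [u [s [uu + ->]]]; elim: s => [|p s IH] sp.
  by rewrite big_nil mulr1; apply: Pu.
rewrite big_cons mulrCA; apply: Pp; first exact/sp/mem_head.
- rewrite mulf_neq0 ?prodf_seq_neq0 //.
    by apply: contraTneq uu => ->; rewrite unitr0.
  apply/allP => q qs; apply/implyP => _.
  by have [] : prime_elt q by apply: sp; rewrite inE qs orbT.
- by apply: IH => q qs; apply: sp; rewrite inE qs orbT.
Qed.

Lemma nonunit_prime_divisor x :
  factored x -> x \isn't a GRing.unit -> exists2 p, prime_elt p & divides p x.
Proof.
elim/factored_ind => [u ->//|p y pp _ _ _]; exists p => //.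
by exists y; rewrite mulrC.
Qed.

End Factorial.

(** * Gauss's lemma and factoriality of polynomial rings in one variable *)

Section FactorialPoly.

Variable R : idomainType.
Hypothesis Rfact : factorial_dom R.
Implicit Types (p c x : R) (f g h : {poly R}).

Definition primitive_poly f : Prop :=
  forall p, prime_elt p -> ~ divides p%:P f.

Lemma divides_polyC c f : divides c%:P f <-> forall i, divides c f`_i.
Proof.
split=> [[g ->] i|cf]; first by exists g`_i; rewrite coefMC.
have [q qE] := choice cf.
exists (\poly_(i < size f) q i); apply/polyP => i; rewrite coefMC coef_poly.
by case: ltnP => // szi; rewrite mul0r nth_default.
Qed.

(* Gauss's lemma: look at the product of the first coefficients of the two
   factors that p does not divide. *)
Lemma prime_polyC p : prime_elt p -> prime_elt p%:P.
Proof.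
case=> p0 pu pP; split; rewrite ?polyC_eq0 //.
  by rewrite poly_unitE size_polyC p0 coefC.
move=> f g pfg; apply: contrapT => /not_orP[pf pg].
have ex h : ~ divides p%:P h -> exists i, ~~ `[< divides p h`_i >].
  move=> ph; apply: contrapT => nex; apply: ph; apply/divides_polyC => i.
  by apply: contrapT => ni; apply: nex; exists i; apply/asboolPn.
case: (ex_minnP (ex f pf)) => i /asboolPn fi imin.
case: (ex_minnP (ex g pg)) => j /asboolPn gj jmin.
have/divides_polyC/(_ (i + j)%N) := pfg.
rewrite coefM => -[z].
have lti : (i < (i + j).+1)%N by rewrite ltnS leq_addr.
rewrite (bigD1 (Ordinal lti)) //= addKn => eqz.
suff : divides p (f`_i * g`_j) by case/pP.
rewrite -[f`_i * _](addrK (\sum_(i0 < (i + j).+1 | i0 != Ordinal lti)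
  f`_i0 * g`_(i + j - i0))) eqz.
apply: divides_add; first by exists z.
rewrite -sumrN; apply: divides_sum => l li; rewrite -mulNr.
have [ltl|gtl|eql] := ltngtP l i; last 1 first.
- by case/eqP: li; apply: val_inj.
- apply: divides_mulr; rewrite -[- _]mulN1r; apply: divides_mull.
  by apply: contrapT => /asboolPn/imin; rewrite leqNgt ltl.
- apply: divides_mull; apply: contrapT => /asboolPn/jmin.
  rewrite leqNgt => /negP; apply.
  by rewrite ltn_subLR ?ltn_add2r // -ltnS.
Qed.

(** Strip the primes of [c] one at a time: by Gauss's lemma each stays prime as a constant
    polynomial, and as it cannot divide the primitive [f] it divides [h]. *)
Lemma primitive_cancel f c g h :
  primitive_poly f -> c != 0 -> c%:P * g = h * f -> divides f g.
Proof.
move=> fprim /Rfact cfact; elim/factored_ind: cfact h => [u uu|p x pp x0 IH] h.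
  move=> eq; exists (u^-1%:P * h).
  by rewrite -mulrA -eq mulrA -polyCM mulVr // mul1r.
move=> eq; have [pp0 _ pP] := prime_polyC pp.
have [|[h' h'E]|/(fprim _ pp)//] := pP h f.
  by rewrite -eq polyCM -mulrA mulrC; exists (x%:P * g).
apply: (IH h'); apply: (mulfI pp0).
by rewrite mulrA -polyCM eq h'E mulrAC mulrC mulrA.
Qed.

Lemma primitive_part f :
  f != 0 -> exists c f0, [/\ c != 0, primitive_poly f0 & f = c%:P * f0].
Proof.
move=> f0; have lc0 : lead_coef f != 0 by rewrite lead_coef_eq0.
(* This bounds the content: every constant factor of [f] divides [y], initially the leading
   coefficient, and the induction is on the factorisation of [y]. A prime of [y] is either taken out
   of [f] or divides no constant factor of [f], and can then be dropped. *)
have : forall c, divides c%:P f -> divides c (lead_coef f).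
  by move=> c /divides_polyC/(_ (size f).-1).
move: (lead_coef f) (Rfact lc0) f0 => y yF {lc0}.
elim/factored_ind: yF f => [u uu|p x pp x0 IH] f f0 cf.
  exists 1, f; split; rewrite ?oner_eq0 ?mul1r // => p [_ pu _] /cf pu'.
  by case/negP: pu; apply: divides_unit pu' uu.
have [pn0 _ pP] := pp.
have [[f' f'E]|npf] := pselect (divides p%:P f).
  have f'0 : f' != 0 by apply: contraNneq f0 => f'0; rewrite f'E f'0 mul0r.
  have [c' [z zE]|c [f1 [c0 f1p f1E]]] := IH f' f'0.
    have [|w] := cf (c' * p).
      by exists z; rewrite f'E zE polyCM mulrA.
    rewrite mulrA [RHS]mulrC => /(mulfI pn0) ->.
    by exists w.
  exists (c * p), f1; split; rewrite ?mulf_neq0 //.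
  by rewrite f'E f1E polyCM mulrAC.
apply: IH => // c cdf; have [c' c'E] := cf c cdf.
have [|[w wE]|[w wE]] := pP c' c.
- by exists x; rewrite -c'E mulrC.
- exists w; apply: (mulfI pn0); rewrite c'E wE.
  by rewrite mulrA [p * w]mulrC.
- case: npf; case: cdf => v ->; exists (v * w%:P).
  by rewrite wE polyCM mulrA.
Qed.

(** Euclid without the fraction field: by pseudo-division, the primitive part of a nonzero
    combination of [f] and [g] of least size divides both. Irreducibility makes either it or its
    cofactor in [f] constant; in the first case [f] divides [h], in the second [g]. *)
Lemma primitive_irreducible_prime f :
  primitive_poly f -> (1 < size f)%N ->
  (forall g h, f = g * h -> (size g <= 1)%N \/ (size h <= 1)%N) ->
  prime_elt f.
Proof.
move=> fprim f1 firr.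
have f0 : f != 0 by rewrite -size_poly_gt0 ltnW.
split=> // [|g h [r rE]].
  by rewrite poly_unitE; case: eqP f1 => // ->.
pose P d := `[< exists a b, a * f + b * g != 0 /\ size (a * f + b * g) = d >].
have exP : exists d, P d.
  by exists (size f); apply/asboolP; exists 1, 0; rewrite mul1r mul0r addr0.
case: (ex_minnP exP) => d /asboolP[a [b []]]; set m := a * f + b * g.
move=> m0 sm dmin.
have mdvd l : (exists a' b', l = a' * f + b' * g) ->
    exists c q, c != 0 /\ c%:P * l = q * m.
  case=> a' [b' lE].
  have := Pdiv.Idomain.divp_eq l m; set c := _ ^+ _; set q := (_ %/ _)%R.
  move=> E; have c0 : c != 0 by rewrite expf_neq0 // lead_coef_eq0.
  exists c, q; split=> //; rewrite mul_polyC E.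
  have [->|rem0] := eqVneq (l %% m) 0; first by rewrite addr0.
  suff /dmin : P (size (l %% m)) by rewrite -sm leqNgt ltn_modp m0.
  apply/asboolP; exists (c%:P * a' - q * a), (c%:P * b' - q * b).
  suff -> : (c%:P * a' - q * a) * f + (c%:P * b' - q * b) * g = l %% m by [].
  have -> : l %% m = c%:P * l - q * m by rewrite mul_polyC E addrC addKr.
  by rewrite lE /m !mulrDl !mulrDr !mulNr opprD !mulrA addrACA.
have [c0 [m0' [c00 m0p mE]]] := primitive_part m0.
have m0dvd l : (exists a' b', l = a' * f + b' * g) -> divides m0' l.
  case/mdvd=> c [q [cn0 E]]; apply: (@primitive_cancel _ c _ (q * c0%:P)) => //.
  by rewrite E mE mulrA.
have [|q qE] := m0dvd f; first by exists 1, 0; rewrite mul1r mul0r addr0.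
have [q1|m1] := firr _ _ qE.
- left; have [w wE] : divides m0' g.
    by apply: m0dvd; exists 0, 1; rewrite mul1r mul0r add0r.
  move: (size1_polyC q1) => qC; move: qE; rewrite qC => qE.
  have qu : q`_0 \is a GRing.unit.
    apply: contrapT => /negP nu; have q00 : q`_0 != 0.
      by apply: contraNneq f0 => q00; rewrite qE q00 mul0r.
    have [p pp [z zE]] := nonunit_prime_divisor (Rfact q00) nu.
    by apply: (fprim p pp); exists (z%:P * m0'); rewrite qE zE polyCM mulrAC.
  exists (w * (q`_0)^-1%:P); rewrite qE -mulrA [_^-1%:P * _]mulrA -polyCM.
  by rewrite mulVr // mul1r.
- right; move: (size1_polyC m1) => mC.
  have cm0 : c0 * m0'`_0 != 0.
    by rewrite -polyC_eq0 polyCM -mC -mE.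
  apply: (@primitive_cancel _ (c0 * m0'`_0) _ (a * h + b * r)) => //.
  rewrite polyCM -mC -mE /m !mulrDl -[b * r * f]mulrA -rE.
  by rewrite mulrAC [b * (g * h)]mulrA.
Qed.

Lemma factorial_poly : factorial_dom {poly R}.
Proof.
move=> f; have [n] := ubnP (size f); elim: n f => // n IH f; rewrite ltnS => fn f0.
have [c [f1 [c0 f1p fE]]] := primitive_part f0.
rewrite fE; apply: factoredM.
  elim/factored_ind: (Rfact c0) => [u uu|p x pp _ xP].
    have u0 : u != 0 by apply: contraTneq uu => ->; rewrite unitr0.
    by apply: factored_unit; rewrite poly_unitE size_polyC u0 coefC uu.
  by rewrite polyCM; apply: factoredM => //; apply/factored_prime/prime_polyC.
have f10 : f1 != 0 by apply: contraNneq f0 => f10; rewrite fE f10 mulr0.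
have szf1 : size f1 = size f by rewrite fE size_Cmul.
have [sz1|sz1] := leqP (size f1) 1.
  apply: factored_unit; rewrite (size1_polyC sz1).
  have f00 : f1`_0 != 0.
    by apply: contraNneq f10 => f00; rewrite (size1_polyC sz1) f00.
  rewrite poly_unitE size_polyC f00 coefC /=.
  apply: contrapT => /negP nu.
  have [p pp [z zE]] := nonunit_prime_divisor (Rfact f00) nu.
  by apply: (f1p p pp); exists z%:P; rewrite (size1_polyC sz1) zE polyCM.
have [irr|red] := pselect (forall g h, f1 = g * h -> (size g <= 1)%N \/ (size h <= 1)%N).
  exact/factored_prime/primitive_irreducible_prime.
have [g [h [f1E g1 h1]]] : exists g h, [/\ f1 = g * h, (1 < size g)%N & (1 < size h)%N].
  apply: contrapT => nex; apply: red => g h E; apply: contrapT => /not_orP[g1 h1].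
  by apply: nex; exists g, h; split=> //; rewrite ltnNge; apply/negP.
have g0 : g != 0 by rewrite -size_poly_gt0 ltnW.
have h0 : h != 0 by rewrite -size_poly_gt0 ltnW.
have szgh : size f = (size g + size h).-1 by rewrite -szf1 f1E size_mul.
rewrite f1E; apply: factoredM; apply: IH => //; apply: leq_trans fn; rewrite szgh.
  by rewrite -subn1 ltn_subRL addnC ltn_add2l.
by rewrite -subn1 ltn_subRL ltn_add2r.
Qed.

End FactorialPoly.

(** * Multivariate polynomial rings are factorial *)

Lemma mpoly_rmorph_ext (n : nat) (R S : comNzRingType)
    (f g : {rmorphism {mpoly R[n]} -> S}) :
  (forall c, f c%:MP = g c%:MP) -> (forall i, f 'X_i = g 'X_i) -> f =1 g.
Proof.
move=> fgC fgX p; elim/mpolyind: p => [|c m p _ _ IH]; first by rewrite !rmorph0.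
rewrite !rmorphD IH -mul_mpolyC !rmorphM fgC; congr (_ * _ + _).
by rewrite mpolyXE_id !rmorph_prod; apply: eq_bigr => i _; rewrite !rmorphXn fgX.
Qed.

Lemma factorial_iso (R S : idomainType) (f : {rmorphism R -> S})
    (g : {rmorphism S -> R}) :
  cancel f g -> cancel g f -> factorial_dom R -> factorial_dom S.
Proof.
move=> fK gK Rfact x x0.
have gx0 : g x != 0 by apply: contraNneq x0 => gx0; rewrite -(gK x) gx0 rmorph0.
rewrite -(gK x); elim/factored_ind: (Rfact _ gx0) => [u uu|p y [p0 pu pP] _ IH].
  by apply/factored_unit/rmorph_unit.
rewrite rmorphM; apply: factoredM => //; apply: factored_prime; split.
- by apply: contraNneq p0 => fp0; rewrite -(fK p) fp0 rmorph0.
- by apply: contraNN pu => /(rmorph_unit g); rewrite fK.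
- move=> a b [z zE]; have [|[w wE]|[w wE]] := pP (g a) (g b).
  + by exists (g z); rewrite -rmorphM zE rmorphM fK.
  + by left; exists (f w); rewrite -rmorphM -wE gK.
  + by right; exists (f w); rewrite -rmorphM -wE gK.
Qed.

Section MpolyAsPoly.

Variables (R : comNzRingType) (n : nat).

Definition mpoly_of_poly : {rmorphism {poly {mpoly R[n]}} -> {mpoly R[n.+1]}} :=
  horner_eval 'X_ord_max \o map_poly (@mwiden n R).

Definition poly_of_mpoly : {rmorphism {mpoly R[n.+1]} -> {poly {mpoly R[n]}}} :=
  mmap (polyC \o @mpolyC n R)
    (fun i => oapp (fun j => ('X_j)%:P) 'X (unlift ord_max i)).

Lemma mpoly_of_polyC p : mpoly_of_poly p%:P = mwiden p.
Proof. by rewrite /= map_polyC horner_evalE hornerC. Qed.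

Lemma mpoly_of_polyX : mpoly_of_poly 'X = 'X_ord_max.
Proof. by rewrite /= map_polyX horner_evalE hornerX. Qed.

Lemma poly_of_mpolyC c : poly_of_mpoly c%:MP = (c%:MP)%:P.
Proof. by rewrite /= mmapC. Qed.

Lemma poly_of_mpolyX i :
  poly_of_mpoly 'X_i = oapp (fun j => ('X_j)%:P) 'X (unlift ord_max i).
Proof. by rewrite /= mmapX mmap1U. Qed.

Lemma mwidenXU j : mwiden 'X_j = 'X_(lift ord_max j) :> {mpoly R[n.+1]}.
Proof.
rewrite /mwiden mmapX mmap1U; congr ('X_ _).
by apply: val_inj; rewrite /= /bump leqNgt ltn_ord.
Qed.

Lemma mpoly_of_polyK : cancel mpoly_of_poly poly_of_mpoly.
Proof.
have downw q : poly_of_mpoly (mwiden q) = q%:P.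
  apply: (@mpoly_rmorph_ext n R _ (poly_of_mpoly \o @mwiden n R) polyC) => [c|j].
    by rewrite /= mwidenC mmapC.
  by rewrite -[LHS]/(poly_of_mpoly (mwiden 'X_j)) mwidenXU poly_of_mpolyX liftK.
elim/poly_ind=> [|p c IHp]; first by rewrite !rmorph0.
rewrite !rmorphD !rmorphM IHp mpoly_of_polyX poly_of_mpolyX mpoly_of_polyC downw.
by rewrite unlift_none.
Qed.

Lemma poly_of_mpolyK : cancel poly_of_mpoly mpoly_of_poly.
Proof.
apply: (@mpoly_rmorph_ext n.+1 R _ (mpoly_of_poly \o poly_of_mpoly) idfun) => [c|j].
  by rewrite -[LHS]/(mpoly_of_poly (poly_of_mpoly c%:MP)) poly_of_mpolyC mpoly_of_polyC mwidenC.
rewrite -[LHS]/(mpoly_of_poly (poly_of_mpoly 'X_j)) poly_of_mpolyX.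
by case: unliftP => [i ->|->]; rewrite [oapp _ _ _]/= ?mpoly_of_polyC ?mpoly_of_polyX ?mwidenXU.
Qed.

End MpolyAsPoly.

Lemma factorial_mpoly (R : idomainType) n :
  factorial_dom R -> factorial_dom {mpoly R[n]}.
Proof.
move=> Rfact; elim: n => [|n IH]; last first.
  exact: factorial_iso (@mpoly_of_polyK R n) (@poly_of_mpolyK R n) (factorial_poly IH).
apply: (@factorial_iso _ _ (@mpolyC 0 R) (meval (fun=> 0))) => // c.
  exact: mevalC.
apply: (@mpoly_rmorph_ext 0 R _ (@mpolyC 0 R \o meval (fun=> 0)) idfun) => [d|[]//].
by rewrite /=; congr (_%:MP); apply: mevalC.
Qed.

Lemma factorial_field (k : fieldType) : factorial_dom k.
Proof. by move=> x x0; apply: factored_unit; rewrite unitfE. Qed.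

(* If p is a primitive polynomial of least degree killing z, Gauss's lemma makes
   its leading coefficient divide a power of every d for which d^N z is integral. *)
Lemma integral_by_coprime_multipliers (A : idomainType) (E : fieldType)
    (i : {rmorphism A -> E}) (F : A -> Prop) (z : E) :
  factorial_dom A -> injective i ->
  (exists2 d, F d & d != 0) ->
  (forall p, prime_elt p -> exists2 d, F d & ~ divides p d) ->
  (forall d, F d -> exists N, integralOver i (i (d ^+ N) * z)) ->
  integralOver i z.
Proof.
move=> Afact injA [d0 Fd0 d00] Fcop zint.
(* If the monic [q] kills [d^N z], then [q(d^N X)] kills [z] and its leading coefficient is a power
   of [d]. *)
have ann d : F d -> d != 0 ->
    exists (q : {poly A}) N, root (map_poly i q) z /\ lead_coef q = d ^+ N.
  move=> Fd dn0; have [N [q qmon qroot]] := zint d Fd.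
  have dN0 : d ^+ N != 0 by rewrite expf_neq0.
  have sz : size ((d ^+ N)%:P * 'X : {poly A}) = 2%N.
    by rewrite size_Cmul // size_polyX.
  exists (q \Po ((d ^+ N)%:P * 'X)), (N * (size q).-1)%N; split.
    rewrite map_comp_poly rmorphM /= map_polyC map_polyX /root horner_comp.
    by rewrite !hornerE /=.
  rewrite lead_coef_comp ?sz // (monicP qmon) mul1r lead_coefM lead_coefC.
  by rewrite lead_coefX mulr1 exprM.
pose P n := `[< exists q : {poly A}, [/\ q != 0, root (map_poly i q) z & size q = n] >].
have exP : exists n, P n.
  have [q [N [qz lq]]] := ann _ Fd0 d00; exists (size q); apply/asboolP.
  by exists q; split=> //; rewrite -lead_coef_eq0 lq expf_neq0.
case: (ex_minnP exP) => n /asboolP[q [q0 qz sq]] nmin.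
have [c [p [c0 pprim qE]]] := primitive_part Afact q0.
have ic0 x : x != 0 -> i x != 0 by move=> x0; rewrite -(rmorph0 i) inj_eq.
have p0 : p != 0 by apply: contraNneq q0 => p0; rewrite qE p0 mulr0.
have pz : root (map_poly i p) z.
  move: qz; rewrite qE rmorphM /= map_polyC /root hornerM hornerC mulf_eq0.
  by rewrite (negbTE (ic0 _ c0)).
have sp : size p = n by rewrite -sq qE size_Cmul.
have lu : lead_coef p \is a GRing.unit.
  apply: contrapT => /negP lnu.
  have lp0 : lead_coef p != 0 by rewrite lead_coef_eq0.
  have [r rp rl] := nonunit_prime_divisor (Afact _ lp0) lnu.
  have [d Fd rd] := Fcop r rp.
  have dn0 : d != 0.
    by apply/eqP => dE; apply: rd; rewrite dE; exists 0; rewrite mul0r.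
  have [q' [N [q'z lq']]] := ann d Fd dn0.
  have qpE := Pdiv.Idomain.divp_eq q' p.
  have rem0 : q' %% p = 0.
    apply: contrapT => /eqP rem0.
    have /nmin : P (size (q' %% p)); last by rewrite -sp leqNgt ltn_modp p0.
    apply/asboolP; exists (q' %% p); split=> //.
    move/(congr1 (fun f => (map_poly i f).[z])): qpE.
    rewrite !(rmorphD, rmorphM) /= map_polyZ /= hornerZ hornerD hornerM.
    by move/eqP: q'z => ->; move/eqP: pz => ->; rewrite !mulr0 add0r => /esym/eqP.
  have [||h hE] := @primitive_cancel _ Afact p (lead_coef p ^+ scalp q' p) q'
    (q' %/ p) pprim.
  - by rewrite expf_neq0.
  - by rewrite mul_polyC qpE rem0 addr0.
  apply/rd/(prime_divides_exp (n := N) rp); rewrite -lq' hE lead_coefM.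
  exact: divides_mull.
exists ((lead_coef p)^-1%:P * p).
  by rewrite monicE lead_coefM lead_coefC mulVr.
rewrite rmorphM /= map_polyC /root hornerM; move/eqP: pz => ->.
by rewrite mulr0.
Qed.

(** * Root fields and extension of derivations *)

Section RootField.

Variables (A : idomainType).

Lemma fraction_denominator (x : {fraction A}) :
  exists a b, a != 0 /\ FracField.tofrac a * x = FracField.tofrac b.
Proof.
elim/quotW: x => r; exists (\d_r), (\n_r); split; first exact: denom_ratioP.
unlock FracField.tofrac; rewrite -[LHS]FracField.pi_mul.
apply/eqmodP; rewrite /= FracField.equivfE /FracField.mulf.
rewrite !numden_Ratio ?mulf_neq0 ?oner_neq0 ?denom_ratioP //.
by rewrite mulr1 mul1r mulrC.
Qed.

Lemma poly_denominator (L : fieldType) (f : {rmorphism A -> L}) (q : {poly L}) :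
  (forall x, exists a b, a != 0 /\ f a * x = f b) ->
  exists a (Q : {poly A}), a != 0 /\ (f a)%:P * q = map_poly f Q.
Proof.
move=> den; elim/poly_ind: q => [|r c [a [Q [a0 IH]]]].
  by exists 1, 0; rewrite oner_eq0 mulr0 map_poly0.
have [b [d [b0 bd]]] := den c.
exists (a * b), (b%:P * Q * 'X + (a * d)%:P); split; first by rewrite mulf_neq0.
rewrite !(rmorphD, rmorphM) /= map_polyX !map_polyC /= -IH -bd !polyCM.
by ring.
Qed.

Lemma irreducible_factor (L : fieldType) (p : {poly L}) :
  (1 < size p)%N -> exists2 q, irreducible_poly q & q %| p.
Proof.
move=> p1; pose P n := `[< exists q : {poly L}, [/\ (1 < size q)%N, q %| p & size q = n] >].
have exP : exists n, P n by exists (size p); apply/asboolP; exists p; rewrite dvdpp.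
case: (ex_minnP exP) => n /asboolP[q [q1 qp sq]] nmin; exists q => //; split=> // r r1 rq.
rewrite -dvdp_size_eqp // eqn_leq dvdp_leq //=; last by rewrite -size_poly_gt0 ltnW.
rewrite sq; apply: nmin; apply/asboolP; exists r; split=> //.
  have r0 : r != 0.
    by apply: contraTneq rq => ->; rewrite dvd0p -size_poly_eq0; case: size q1.
  by rewrite ltn_neqAle eq_sym r1 size_poly_gt0.
exact: dvdp_trans rq qp.
Qed.

(** [P] may be reducible over the fraction field, so [y] is a root of one irreducible factor. The
    last clause says, without fractions, that [y] generates E over the fractions of A. *)
Lemma root_field (P : {poly A}) : P \is monic -> (1 < size P)%N ->
  exists (E : fieldType) (i : {rmorphism A -> E}) (y : E),
    [/\ injective i, root (map_poly i P) y &
       forall e, exists a (Q : {poly A}), a != 0 /\ i a * e = (map_poly i Q).[y]].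
Proof.
move=> Pmon P1; pose L := {fraction A}.
pose f : {rmorphism A -> L} := @FracField.tofrac A.
have finj : injective f by move=> a b /eqP; rewrite tofrac_eq => /eqP.
have P1' : (1 < size (map_poly f P))%N by rewrite size_map_inj_poly ?rmorph0.
have [p pirr pP] := irreducible_factor P1'.
have [E _ [y py yE]] := irredp_FAdjoin pirr.
exists E, (in_alg E \o f), y; split.
- by move=> a b /= ab; apply/finj/(fmorph_inj (in_alg E)).
- by rewrite map_poly_comp; case/dvdpP: pP => q ->; rewrite rmorphM rootM py orbT.
- move=> e; have [q qE ->] : exists2 q : {poly L}, true & e = (map_poly (in_alg E) q).[y].
    have : e \in <<1; y>>%VS by rewrite yE memvf.
    case/Fadjoin_polyP=> q /polyOver1P[q' ->] ->.
    by exists q'.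
  have [a [Q [a0 QE]]] := @poly_denominator L f q fraction_denominator.
  exists a, Q; split=> //; rewrite map_poly_comp -QE rmorphM hornerM /= map_polyC.
  by rewrite hornerC.
Qed.

End RootField.

Section Derivations.

Definition derivation_along (R S : nzRingType) (f D : R -> S) : Prop :=
  (forall x y, D (x + y) = D x + D y) /\
  (forall x y, D (x * y) = D x * f y + f x * D y).

Lemma derivation0 (R S : nzRingType) (f D : R -> S) :
  derivation_along f D -> D 0 = 0.
Proof. by case=> DD _; apply: (addIr (D 0)); rewrite -DD !add0r. Qed.

Lemma derivation_sum (R S : nzRingType) (f D : R -> S) (I : Type) (r : seq I)
    (P : pred I) (F : I -> R) : derivation_along f D ->
  D (\sum_(i <- r | P i) F i) = \sum_(i <- r | P i) D (F i).
Proof. by move=> dD; apply: big_morph => [|]; [apply: dD.1 | apply: derivation0 dD]. Qed.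

Lemma derivation1 (R S : nzRingType) (f : {rmorphism R -> S}) (D : R -> S) :
  derivation_along f D -> D 1 = 0.
Proof.
move=> dD; apply: (addIr (D 1)); rewrite add0r.
by rewrite -[in RHS](mulr1 1) dD.2 rmorph1 mulr1 mul1r.
Qed.

Variables (A : idomainType) (E : fieldType) (i : {rmorphism A -> E}).
Variable d : A -> E.
Hypothesis dd : derivation_along i d.

(* The derivative of Q(y), where y' stands for the derivative of y. *)
Definition poly_derivation (y y' : E) (Q : {poly A}) : E :=
  (map_poly d Q).[y] + (map_poly i Q)^`().[y] * y'.

Lemma poly_derivationD y y' Q R :
  poly_derivation y y' (Q + R) = poly_derivation y y' Q + poly_derivation y y' R.
Proof.
rewrite /poly_derivation rmorphD derivD !hornerD.
have -> : map_poly d (Q + R) = map_poly d Q + map_poly d R.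
  by apply/polyP => j; rewrite coefD !coef_map_id0 ?(derivation0 dd) // coefD dd.1.
by rewrite hornerD; ring.
Qed.

Lemma poly_derivationM y y' Q R :
  poly_derivation y y' (Q * R) =
  poly_derivation y y' Q * (map_poly i R).[y]
  + (map_poly i Q).[y] * poly_derivation y y' R.
Proof.
rewrite /poly_derivation rmorphM derivM !hornerD !hornerM.
have -> : map_poly d (Q * R) = map_poly d Q * map_poly i R + map_poly i Q * map_poly d R.
  apply/polyP => j; rewrite coefD coef_map_id0 ?(derivation0 dd) // !coefM.
  rewrite (derivation_sum _ _ _ dd) -big_split; apply: eq_bigr => l _.
  by rewrite dd.2 !coef_map /= !coef_map_id0 ?(derivation0 dd).
by rewrite hornerD !hornerM; ring.
Qed.

Lemma poly_derivationC y y' a : poly_derivation y y' a%:P = d a.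
Proof.
rewrite /poly_derivation map_polyC derivC horner0 mul0r addr0.
have -> : map_poly d a%:P = (d a)%:P.
  apply/polyP => j; rewrite coef_map_id0 ?(derivation0 dd) // !coefC.
  by case: eqP => _; rewrite ?(derivation0 dd).
by rewrite hornerC.
Qed.

Lemma poly_derivation_horner (D : E -> E) y Q :
  derivation_along idfun D -> (forall a, D (i a) = d a) ->
  D (map_poly i Q).[y] = poly_derivation y (D y) Q.
Proof.
move=> dD Di; elim/poly_ind: Q => [|Q c IH].
  by rewrite map_poly0 horner0 (derivation0 dD) -polyC0 poly_derivationC (derivation0 dd).
rewrite rmorphD rmorphM /= map_polyX map_polyC !hornerE dD.1 dD.2 Di IH.
rewrite poly_derivationD poly_derivationM poly_derivationC; congr (_ * _ + _ * _ + _).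
  by rewrite map_polyX hornerX.
rewrite /poly_derivation map_polyX derivX hornerC mul1r.
have -> : map_poly d 'X = 0.
  apply/polyP => j; rewrite coef_map_id0 ?(derivation0 dd) // coefX coef0.
  by case: eqP => _; rewrite ?(derivation0 dd) ?(derivation1 dd).
by rewrite horner0 add0r.
Qed.

Hypothesis A_char : [pchar A] =i pred0.
Hypothesis i_inj : injective i.
Variable y : E.
Hypothesis y_gen :
  forall e, exists a (Q : {poly A}), a != 0 /\ i a * e = (map_poly i Q).[y].
Variable P : {poly A}.
Hypothesis P0 : P != 0.
Hypothesis Py : root (map_poly i P) y.

(** In characteristic zero the minimal equation [p] of [y] is separable, so differentiating
    [p(y) = 0] determines the derivative of [y], and clearing denominators determines all the
    rest. *)
Lemma derivation_extends :
  exists D : E -> E, derivation_along idfun D /\ forall a, D (i a) = d a.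
Proof.
have ineq0 a : a != 0 -> i a != 0 by move=> a0; rewrite -(rmorph0 i) inj_eq.
pose Z n := `[< exists q : {poly A}, [/\ q != 0, root (map_poly i q) y & size q = n] >].
have exZ : exists n, Z n by exists (size P); apply/asboolP; exists P.
case: (ex_minnP exZ) => n /asboolP[p [p0 py sp]] nmin.
have small q : (map_poly i q).[y] = 0 -> (size q < size p)%N -> q = 0.
  move=> qy; rewrite sp ltnNge; apply: contraNeq => q0; apply: nmin; apply/asboolP.
  by exists q; split=> //; apply/eqP.
have p1 : (1 < size p)%N.
  rewrite ltnNge; apply: contraNN p0 => p1; rewrite (size1_polyC p1) polyC_eq0.
  move: py; rewrite {1}(size1_polyC p1) map_polyC /root hornerC.
  by apply: contraTT; apply: ineq0.
have dp0 : (map_poly i p)^`().[y] != 0.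
  apply/negP => /eqP; rewrite deriv_map => /small/(_ (lt_size_deriv p0)).
  move/polyP/(_ (size p).-2); rewrite coef_deriv coef0 -mulr_natr => /eqP.
  have -> : (size p).-2.+1 = (size p).-1 by case: size p1 => [|[]].
  rewrite mulf_eq0 -/(lead_coef p) lead_coef_eq0 (negbTE p0) /=.
  by rewrite (pcharf0P A).1 //; case: size p1 => [|[]].
pose y' := - (map_poly d p).[y] / (map_poly i p)^`().[y].
pose dl := poly_derivation y y'.
have dlD := poly_derivationD y y' : {morph dl : Q R / Q + R}.
have dlM Q R : dl (Q * R) = dl Q * (map_poly i R).[y] + (map_poly i Q).[y] * dl R.
  exact: poly_derivationM.
have dlC a : dl a%:P = d a := poly_derivationC y y' a.
have dlp : dl p = 0 by rewrite /dl /poly_derivation /y' mulrC divfK // subrr.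
(* Up to a nonzero constant, a polynomial killing [y] is a multiple of [p], and [dl p = 0]. This
   makes the value of [D] independent of how its argument is written. *)
have dl0 R : (map_poly i R).[y] = 0 -> dl R = 0.
  move=> Ry; have := Pdiv.Idomain.divp_eq R p.
  set c := _ ^+ _; set S := (_ %/ _)%R; set r := (_ %% _)%R => RE.
  have c0 : c != 0 by rewrite expf_neq0 // lead_coef_eq0.
  have r0 : r = 0.
    apply: small; last by rewrite ltn_modp.
    have -> : r = c *: R - S * p by rewrite RE addrC addKr.
    rewrite rmorphB rmorphM /= map_polyZ hornerD hornerN hornerZ Ry hornerM.
    by move/eqP: py => ->; rewrite !mulr0 subrr.
  have : dl (c *: R) = 0.
    rewrite RE r0 addr0 dlM dlp mulr0 addr0.
    by move/eqP: py => ->; rewrite mulr0.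
  rewrite -mul_polyC dlM Ry mulr0 add0r map_polyC hornerC.
  by move/eqP; rewrite mulf_eq0 (negbTE (ineq0 _ c0)) => /eqP.
have genE e : {aQ : A * {poly A} | aQ.1 != 0 /\ i aQ.1 * e = (map_poly i aQ.2).[y]}.
  by apply: cid; have [a [Q aQ]] := y_gen e; exists (a, Q).
pose D e := let: (a, Q) := sval (genE e) in (dl Q - d a * e) / i a.
have DE e a Q : a != 0 -> i a * e = (map_poly i Q).[y] -> i a * D e = dl Q - d a * e.
  rewrite /D; case: (genE e) => -[b R] /= [b0 bE] a0 aE.
  have : dl (a%:P * R - b%:P * Q) = 0.
    apply: dl0; rewrite rmorphB !rmorphM /= !map_polyC hornerD hornerN !hornerM.
    by rewrite !hornerC -aE -bE /=; ring.
  have dlN S : dl (- S) = - dl S.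
    apply: (addIr (dl S)); rewrite -dlD !addNr.
    by rewrite -polyC0 dlC (derivation0 dd).
  rewrite dlD dlN !dlM !map_polyC !hornerC !dlC -aE -bE => /eqP.
  rewrite addr_eq0 opprK => /eqP H.
  apply: (mulfI (ineq0 _ b0)); rewrite mulrCA [i b * (_ / _)]mulrC divfK ?ineq0 //.
  have {}H : i a * dl R = d b * (i a * e) + i b * dl Q - d a * (i b * e).
    by rewrite -H; ring.
  by rewrite mulrBr H; ring.
have Di a : D (i a) = d a.
  have := @DE (i a) 1 a%:P; rewrite oner_eq0 rmorph1 !mul1r map_polyC hornerC.
  by move=> /(_ isT erefl); rewrite (derivation1 dd) mul0r subr0 dlC.
exists D; split=> //; split=> e f.
  have [a [Q [a0 aE]]] := y_gen e; have [b [R [b0 bE]]] := y_gen f.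
  have ab0 : a * b != 0 by rewrite mulf_neq0.
  apply: (mulfI (ineq0 _ ab0)); rewrite (@DE _ _ (b%:P * Q + a%:P * R)) //; last first.
    rewrite rmorphD !rmorphM /= !map_polyC hornerD !hornerM !hornerC -aE -bE /=.
    by ring.
  rewrite dlD !dlM !map_polyC !hornerC -aE -bE !dlC dd.2 rmorphM /=.
  have -> : dl Q = i a * D e + d a * e by rewrite (DE _ _ _ a0 aE) subrK.
  have -> : dl R = i b * D f + d b * f by rewrite (DE _ _ _ b0 bE) subrK.
  by ring.
have [a [Q [a0 aE]]] := y_gen e; have [b [R [b0 bE]]] := y_gen f.
have ab0 : a * b != 0 by rewrite mulf_neq0.
apply: (mulfI (ineq0 _ ab0)); rewrite (@DE _ _ (Q * R)) //; last first.
  by rewrite [map_poly i _]rmorphM hornerM -aE -bE rmorphM /=; ring.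
rewrite !dlM -aE -bE dd.2 rmorphM /=.
have -> : dl Q = i a * D e + d a * e by rewrite (DE _ _ _ a0 aE) subrK.
have -> : dl R = i b * D f + d b * f by rewrite (DE _ _ _ b0 bE) subrK.
by ring.
Qed.

End Derivations.

(** * Lifting through an invariant ring *)

Section GroupActionOnDomain.

Variables (gT : finGroupType) (A : idomainType) (act : gT -> {rmorphism A -> A}).
Hypothesis act1 : forall a, act 1%g a = a.
Hypothesis actM : forall g h a, act (g * h)%g a = act h (act g a).

Definition orbit_poly (a : A) : {poly A} := \prod_g ('X - (act g a)%:P).
Definition orbit_norm (a : A) : A := \prod_g act g a.
(** The different of [a]: the derivative of [orbit_poly a] at [a]. *)
Definition orbit_diff (a : A) : A := \prod_(g | g != 1%g) (a - act g a).

Lemma act_orbit_norm h a : act h (orbit_norm a) = orbit_norm a.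
Proof.
rewrite /orbit_norm rmorph_prod [RHS](reindex_inj (mulIg h)).
by apply: eq_bigr => g _; rewrite actM.
Qed.

Lemma act_orbit_poly h a : map_poly (act h) (orbit_poly a) = orbit_poly a.
Proof.
rewrite /orbit_poly rmorph_prod [RHS](reindex_inj (mulIg h)).
by apply: eq_bigr => g _; rewrite /= rmorphB /= map_polyX map_polyC actM.
Qed.

Lemma orbit_poly_monic a : orbit_poly a \is monic.
Proof. exact: monic_prod_XsubC. Qed.

Lemma root_orbit_poly a : root (orbit_poly a) a.
Proof.
by rewrite /root horner_prod (bigD1 1%g) //= act1 !hornerE subrr mul0r.
Qed.

Lemma act_inj h : injective (act h).
Proof. by apply: (can_inj (g := act h^-1%g)) => a; rewrite -actM mulgV act1. Qed.

Lemma orbit_norm_eq0 a : (orbit_norm a == 0) = (a == 0).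
Proof.
apply/idP/idP => [|/eqP->].
  case/prodf_eq0 => g _ /eqP ga0; apply/eqP/(@act_inj g).
  by rewrite ga0 rmorph0.
by apply/prodf_eq0; exists 1%g; rewrite ?rmorph0.
Qed.

Variables (B : comNzRingType) (j : {rmorphism B -> A}).
Hypothesis j_inj : injective j.
Hypothesis act_j : forall g b, act g (j b) = j b.
Hypothesis j_surj : forall a, (forall g, act g a = a) -> exists b, j b = a.

Lemma invariant_poly_lift (Q : {poly A}) :
  (forall g, map_poly (act g) Q = Q) -> exists Q0, map_poly j Q0 = Q.
Proof.
move=> Qinv; have ex n : exists b, j b = Q`_n.
  by apply: j_surj => g; rewrite -[in RHS](Qinv g) coef_map.
have [q qE] := choice ex.
exists (\poly_(n < size Q) q n); apply/polyP => n; rewrite coef_map coef_poly.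
case: ltnP => [_|szn]; [exact: qE | by rewrite [RHS]nth_default //; apply: rmorph0].
Qed.

Lemma integral_invariants a : integralOver j a.
Proof.
have [P PE] := invariant_poly_lift (fun g => act_orbit_poly g a).
exists P; last by rewrite PE root_orbit_poly.
rewrite monicE -(inj_eq j_inj) -lead_coef_map_inj ?rmorph0 // PE rmorph1.
exact: orbit_poly_monic.
Qed.

(** * Extending a homomorphism from the invariants to the whole ring *)

Section EtaleLifting.

Variables (E : fieldType) (psi : {rmorphism B -> E}) (l : A) (y : E).
Hypothesis psi_inj : injective psi.
Hypothesis l_sep : forall g, g != 1%g -> act g l != l.
Hypothesis y_root : forall P, map_poly j P = orbit_poly l -> root (map_poly psi P) y.

Lemma orbit_diff_neq0 : orbit_diff l != 0.
Proof. by apply/prodf_neq0 => g g1; rewrite subr_eq0 eq_sym l_sep. Qed.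

(* The conjugates of l are pairwise distinct, so a polynomial over the
   invariants that vanishes at l is a multiple of the orbit polynomial. *)
Lemma vanishing_transfer (W : {poly B}) :
  (map_poly j W).[l] = 0 -> (map_poly psi W).[y] = 0.
Proof.
have [P PE] := invariant_poly_lift (fun g => act_orbit_poly g l).
have Pmon : P \is monic.
  rewrite monicE -(inj_eq j_inj) -lead_coef_map_inj ?rmorph0 // PE rmorph1.
  exact: orbit_poly_monic.
have := Pdiv.RingMonic.rdivp_eq Pmon W.
set q := Pdiv.Ring.rdivp _ _; set r := Pdiv.Ring.rmodp _ _ => WE Wl.
have rl : (map_poly j r).[l] = 0.
  move: Wl; rewrite WE rmorphD rmorphM /= PE hornerD hornerM.
  by rewrite (eqP (root_orbit_poly l)) mulr0 add0r.
have r0 : map_poly j r = 0.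
  apply: (@roots_geq_poly_eq0 _ _ [seq act g l | g <- enum gT]).
  - apply/allP => _ /mapP[g _ ->]; rewrite /root.
    have -> : map_poly j r = map_poly (act g) (map_poly j r).
      by apply/polyP => n; rewrite !coef_map /= act_j.
    by rewrite horner_map rl rmorph0.
  - rewrite map_inj_uniq ?enum_uniq // => g h gh; apply/eqP.
    rewrite -[g == h](inj_eq (mulIg h^-1%g)) mulgV; apply: contraT => /l_sep.
    by rewrite actM gh -actM mulgV act1 eqxx.
  - rewrite size_map -cardE size_map_inj_poly ?rmorph0 //.
    have : (size r < size P)%N by rewrite Pdiv.Ring.ltn_rmodpN0 // monic_neq0.
    rewrite -(size_map_inj_poly j_inj (rmorph0 j) P) PE size_prod_XsubC.
    by rewrite /index_enum -enumT -cardE ltnS.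
have {}r0 : r = 0 by apply: (map_inj_poly j_inj (rmorph0 j)); rewrite r0 rmorph0.
rewrite WE r0 addr0 rmorphM hornerM.
by move/eqP: (y_root PE) => ->; rewrite mulr0.
Qed.

(** Lagrange interpolation of the map sending each conjugate of [l] to the corresponding conjugate
    of [a]: the numerator has invariant coefficients, and at [l] only the term of the identity
    survives. *)
Lemma lagrange_numerator a :
  exists Q : {poly B}, (map_poly j Q).[l] = a * orbit_diff l.
Proof.
pose G g := (act g a)%:P * \prod_(h | h != g) ('X - (act h l)%:P).
have GM x g : map_poly (act x) (G g) = G (g * x)%g.
  rewrite /G rmorphM /= map_polyC actM rmorph_prod; congr (_ * _).
  rewrite [RHS](reindex_inj (mulIg x)); apply: eq_big => h.
    by rewrite (inj_eq (mulIg x)).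
  by rewrite /= rmorphB /= map_polyX map_polyC actM.
have [x|Q QE] := @invariant_poly_lift (\sum_g G g).
  rewrite rmorph_sum [RHS](reindex_inj (mulIg x)).
  by apply: eq_bigr => g _; apply: GM.
exists Q; rewrite QE horner_sum (bigD1 1%g) //= big1 ?addr0 => [|g g1].
  rewrite /G hornerM hornerC act1 horner_prod; congr (_ * _).
  by apply: eq_bigr => g _; rewrite !hornerE.
rewrite /G hornerM horner_prod (bigD1 1%g) 1?eq_sym //= act1 !hornerE subrr.
by rewrite /= ?(mul0r, mulr0).
Qed.

(* phi a is the quotient of Q_a by Q_1 at y, where the polynomial Q_a over the
   invariants satisfies Q_a(l) = a * orbit_diff l. *)
Lemma etale_lift :
  exists phi : {rmorphism A -> E}, (forall b, phi (j b) = psi b) /\ phi l = y.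
Proof.
have [Q QE] := choice lagrange_numerator.
pose ev W := (map_poly psi W).[y].
pose evl W := (map_poly j W).[l].
have evD : {morph ev : V W / V + W} by move=> V W; rewrite /ev rmorphD hornerD.
have evM : {morph ev : V W / V * W} by move=> V W; rewrite /ev rmorphM hornerM.
have evC b : ev b%:P = psi b by rewrite /ev map_polyC hornerC.
have evlB V W : evl (V - W) = evl V - evl W by rewrite /evl rmorphB hornerD hornerN.
have evlD : {morph evl : V W / V + W} by move=> V W; rewrite /evl rmorphD hornerD.
have evlM : {morph evl : V W / V * W} by move=> V W; rewrite /evl rmorphM hornerM.
have evlC b : evl b%:P = j b by rewrite /evl map_polyC hornerC.
have transfer V W : evl V = evl W -> ev V = ev W.
  move=> VW; apply/eqP; rewrite -subr_eq0 /ev -hornerN -hornerD -rmorphB.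
  by apply/eqP/vanishing_transfer; rewrite -/(evl _) evlB VW subrr.
have den0 : ev (Q 1) != 0.
  (* The cofactor of [orbit_diff l] in its norm [N]. The relation (e e d) d = N N, with d the
     different, transports to E, where [psi N] is nonzero. *)
  pose e := \prod_(g | g != 1%g) act g (orbit_diff l).
  have [N NE] := @j_surj (orbit_norm (orbit_diff l)) (fun g => act_orbit_norm g _).
  have NE' : j N = orbit_diff l * e.
    by rewrite NE /orbit_norm (bigD1 1%g) //= act1.
  have : ev (Q (e * e)) * ev (Q 1) = psi N * psi N.
    rewrite -!evC -!evM; apply: transfer; rewrite !evlM !evlC NE'.
    by rewrite /evl !QE; ring.
  apply: contra_eq_neq => ->; rewrite mulr0 eq_sym mulf_neq0 //.
    rewrite -(rmorph0 psi) (inj_eq psi_inj) -(inj_eq j_inj) rmorph0 NE.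
    by rewrite orbit_norm_eq0 orbit_diff_neq0.
  rewrite -(rmorph0 psi) (inj_eq psi_inj) -(inj_eq j_inj) rmorph0 NE.
  by rewrite orbit_norm_eq0 orbit_diff_neq0.
pose phi a := ev (Q a) / ev (Q 1).
have phiD : {morph phi : a b / a + b}.
  move=> a b; rewrite /phi -mulrDl -evD; congr (_ / _); apply: transfer.
  by rewrite evlD /evl !QE mulrDl.
have phiM : {morph phi : a b / a * b}.
  move=> a b; rewrite /phi mulrACA -invfM -evM.
  apply: (mulIf den0); rewrite divfK // invfM mulrA divfK //.
  apply: (mulIf den0); rewrite divfK // -evM; apply: transfer.
  by rewrite !evlM /evl !QE; ring.
have phiB : zmod_morphism phi.
  move=> a b; apply: (addIr (phi b)); rewrite -phiD !subrK //.
have phi1 : monoid_morphism phi by split=> //; rewrite /phi divff.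
pose phi' : {rmorphism A -> E} := HB.pack phi
  (GRing.isZmodMorphism.Build A E phi phiB) (GRing.isMonoidMorphism.Build A E phi phi1).
exists phi'; split=> [b|].
  apply: (mulIf den0); rewrite /= /phi divfK // -evC -evM; apply: transfer.
  by rewrite evlM evlC /evl !QE mul1r.
apply: (mulIf den0); rewrite /= /phi divfK //.
have -> : y = ev 'X by rewrite /ev map_polyX hornerX.
rewrite -evM; apply: transfer; rewrite evlM /evl !QE map_polyX hornerX.
by rewrite mul1r.
Qed.

End EtaleLifting.

End GroupActionOnDomain.

(** * Lying over *)

Section LyingOver.

Variables (k : closedFieldType) (R S : comNzRingType) (i : {rmorphism R -> S}).
Variables (c : {rmorphism k -> R}) (chi : {rmorphism R -> k}).
Hypothesis chi_c : forall x, chi (c x) = x.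
Hypothesis i_inj : injective i.
(** A subring of S given by a predicate, so that S can be the field E below, with T its integral
    elements. *)
Variable T : S -> Prop.
Hypothesis T_i : forall r, T (i r).
Hypothesis T_add : forall x y, T x -> T y -> T (x + y).
Hypothesis T_mul : forall x y, T x -> T y -> T (x * y).
Hypothesis T_int : forall x, T x -> integralOver i x.

Let ideal_avoiding (X : set S) : Prop :=
  [/\ forall x, X x -> T x,
      forall a b x y, T a -> T b -> X x -> X y -> X (a * x + b * y)
    & forall r, X (i r) -> chi r = 0].

(* An ideal maximal among those that meet R inside ker chi is prime, and by
   integrality it contains ker chi. *)
Lemma prime_over_character :
  exists X : set S, [/\ ideal_avoiding X, X 0,
    forall x y, T x -> T y -> X (x * y) -> X x \/ X y
    & forall r, chi r = 0 -> X (i r)].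
Proof.
have T0 : T 0 by rewrite -(rmorph0 i).
have T1 : T 1 by rewrite -(rmorph1 i).
have TX x n : T x -> T (x ^+ n) by move=> Tx; elim: n => // n IH; rewrite exprS; apply: T_mul.
have [F Favoid Ftot|X [Xav Xmax]] := @Zorn_bigcup S ideal_avoiding.
  split=> [x [Y FY Yx]|a b x y Ta Tb [Y FY Yx] [Z FZ Zy]|r [Y FY Yr]].
  - by case: (Favoid _ FY) => + _ _; apply.
  - have [YZ|ZY] := Ftot _ _ FY FZ.
      by exists Z => //; case: (Favoid _ FZ) => _ + _; apply => //; apply: YZ.
    by exists Y => //; case: (Favoid _ FY) => _ + _; apply => //; apply: ZY.
  - by case: (Favoid _ FY) => _ _; apply.
have [XT Xlin Xchi] := Xav.
have X0 : X 0.
  (* The empty set is allowed by [ideal_avoiding], because Zorn's lemma also asks for the union of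
     the empty chain. Maximality excludes it here. *)
  apply: contrapT => nX0; apply: (Xmax [set 0]%classic).
    split=> [x Xx|sub]; last by apply: nX0; apply: sub.
    case: nX0; have := Xlin 0 0 x x T0 T0 Xx Xx.
    by rewrite !mul0r addr0.
  split=> [x ->//|a b x y _ _ -> ->|r /= /eqP].
    by rewrite /= !mulr0 addr0.
  by rewrite -(rmorph0 i) (inj_eq i_inj) => /eqP->; rewrite rmorph0.
have Xmul a x : T a -> X x -> X (a * x).
  by move=> Ta Xx; have := Xlin a 0 x 0 Ta T0 Xx X0; rewrite mulr0 addr0.
have Xadd x y : X x -> X y -> X (x + y).
  by move=> Xx Xy; have := Xlin 1 1 x y T1 T1 Xx Xy; rewrite !mul1r.
(* By maximality, the ideal generated by X and [x] must meet the image of R outside ker chi. *)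
have meet x : T x -> ~ X x ->
    exists r a t, [/\ chi r != 0, X a, T t & i r = a + t * x].
  move=> Tx nXx; apply: contrapT => nex.
  apply: (Xmax [set a + t * x | a in X & t in T]%classic).
    split=> [a Xa|sub].
      by exists a => //; exists 0 => //; rewrite mul0r addr0.
    by apply/nXx/sub; exists 0 => //; exists 1 => //; rewrite mul1r add0r.
  split.
  - by move=> _ [a Xa [t Tt <-]]; apply: T_add; [apply: XT | apply: T_mul].
  - move=> u v _ _ Tu Tv [a Xa [t Tt <-]] [b Xb [s Ts <-]].
    exists (u * a + v * b); first exact: Xlin.
    by exists (u * t + v * s); [apply: T_add; apply: T_mul | ring].
  - move=> r [a Xa [t Tt E]]; apply/eqP; apply: contrapT => /negP nr.
    by apply: nex; exists r, a, t.
exists X; split=> // [x y Tx Ty Xxy|r chir].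
  apply: contrapT => /not_orP[/(meet x Tx)[r [a [t [r0 Xa Tt rE]]]]].
  move=> /(meet y Ty)[s [b [u [s0 Xb Tu sE]]]].
  have /eqP : chi (r * s) = 0.
    apply: Xchi; rewrite rmorphM rE sE.
    have -> : (a + t * x) * (b + u * y) = (b + u * y) * a + ((t * x) * b + (t * u) * (x * y)).
      by ring.
    apply: Xadd; first by apply: Xmul => //; rewrite -sE.
    by apply: Xlin => //; apply: T_mul.
  by rewrite rmorphM mulf_eq0 (negbTE r0) (negbTE s0).
apply: contrapT => nXr.
have [s [a [t [s0 Xa Tt sE]]]] := meet _ (T_i r) nXr.
have [q qmon /eqP qt] := T_int Tt.
set n := (size q).-1.
have qn : q`_n = 1 by apply/eqP; rewrite -monicE in qmon *.
have sq : size q = n.+1 by rewrite prednK // size_poly_gt0 monic_neq0.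
(* The equation of [t] multiplied by [r^n]. Modulo X, [t * i r] may be replaced by [i s]; this gives
   an element of R lying in X, whose value under [chi] is [chi s ^+ n] since [chi r = 0]. *)
have tr : \sum_(m < n.+1) i (q`_m * r ^+ (n - m)) * (t * i r) ^+ m = 0.
  transitivity (i r ^+ n * (map_poly i q).[t]); last by rewrite qt mulr0.
  rewrite horner_coef size_map_poly_id0 ?sq.
    rewrite mulr_sumr; apply: eq_bigr => m _; rewrite coef_map /= rmorphM rmorphXn.
    rewrite exprMn.
    have -> : i r ^+ n = i r ^+ (n - m) * i r ^+ m by rewrite -exprD subnK // leq_ord.
    by ring.
  by rewrite (monicP qmon) rmorph1 oner_neq0.
have Xdiff m : X (i s ^+ m - (t * i r) ^+ m).
  elim: m => [|m IH]; first by rewrite subrr.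
  rewrite !exprS.
  have -> : i s * i s ^+ m - t * i r * (t * i r) ^+ m
    = i s * (i s ^+ m - (t * i r) ^+ m) + (t * i r) ^+ m * a by rewrite sE; ring.
  apply: Xadd; apply: Xmul => //; apply: TX; exact: T_mul.
have : X (i (\sum_(m < n.+1) q`_m * r ^+ (n - m) * s ^+ m)).
  rewrite -[i _]subr0 -tr rmorph_sum -sumrB.
  elim/big_ind: _ => // m _.
  rewrite rmorphM rmorphXn -mulrBr; exact: Xmul.
move/Xchi; rewrite rmorph_sum big_ord_recr /= subnn qn !mul1r big1.
  by rewrite add0r rmorphXn => /eqP; rewrite expf_eq0 (negbTE s0) andbF.
move=> m _; rewrite !rmorphM rmorphXn chir expr0n subn_eq0 leqNgt ltn_ord.
by rewrite mulr0 mul0r.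
Qed.

(** Modulo the prime X, a monic equation for [x] over R gets coefficients in k and splits into
    linear factors. So [x] is congruent to a scalar, which is its value; outside T the value is
    arbitrary. *)
Lemma lying_over : exists chi' : S -> k,
  [/\ forall x y, T x -> T y -> chi' (x + y) = chi' x + chi' y,
      forall x y, T x -> T y -> chi' (x * y) = chi' x * chi' y
    & forall r, chi' (i r) = chi r].
Proof.
have [X [[XT Xlin Xchi] X0 Xprime Xker]] := prime_over_character.
have T1 : T 1 by rewrite -(rmorph1 i).
have TN x : T x -> T (- x).
  by move=> Tx; rewrite -mulN1r -(rmorph1 i) -rmorphN; apply: T_mul.
have Xmul a x : T a -> X x -> X (a * x).
  by move=> Ta Xx; have := Xlin a 1 x 0 Ta T1 Xx X0; rewrite mulr0 addr0.
have Xadd x y : X x -> X y -> X (x + y).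
  by move=> Xx Xy; have := Xlin 1 1 x y T1 T1 Xx Xy; rewrite !mul1r.
have val x : exists a : k, T x -> X (x - i (c a)).
  have [Tx|nTx] := pselect (T x); last by exists 0.
  have [q qmon /eqP qx] := T_int Tx.
  have [rs rsE] := closed_field_poly_normal (map_poly chi q).
  have qlead : lead_coef (map_poly chi q) = 1 by apply/monicP/monic_map.
  rewrite qlead scale1r in rsE.
  have prodX : X (\prod_(a <- rs) (x - i (c a))).
    have -> : \prod_(a <- rs) (x - i (c a)) =
        (map_poly i (map_poly c (map_poly chi q) - q)).[x].
      rewrite rmorphB hornerD hornerN qx subr0 rsE !rmorph_prod horner_prod.
      apply: eq_bigr => a _; rewrite /= !rmorphB /= !map_polyX !map_polyC.
      by rewrite !hornerE.
    rewrite horner_coef; elim/big_ind: _ => // m _.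
    rewrite mulrC; apply: Xmul.
      by elim: (m : nat) => // n IH; rewrite exprS; apply: T_mul.
    by rewrite coef_map; apply: Xker; rewrite coefB !coef_map rmorphB chi_c subrr.
  elim: rs {rsE} prodX => [|a rs IH].
    rewrite big_nil => X1; have := Xchi 1; rewrite !rmorph1 => /(_ X1)/eqP.
    by rewrite oner_eq0.
  rewrite big_cons => /Xprime[|||//]; last by exists a.
    by apply/T_add/TN.
  by elim/big_ind: _ => // b _; apply/T_add/TN.
have [chi' chi'E] := choice val.
have uniq_val x a : T x -> X (x - i (c a)) -> chi' x = a.
  move=> Tx Xa; apply/eqP; rewrite -subr_eq0 -[_ - _]chi_c; apply/eqP/Xchi.
  have -> : i (c (chi' x - a)) = (x - i (c a)) + (i (- 1)) * (x - i (c (chi' x))).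
    by rewrite !rmorphB !rmorphN !rmorph1; ring.
  by apply: Xadd => //; apply: Xmul => //; apply: chi'E.
exists chi'; split=> [x y Tx Ty|x y Tx Ty|r].
- apply: uniq_val; first exact: T_add.
  have -> : x + y - i (c (chi' x + chi' y)) = (x - i (c (chi' x))) + (y - i (c (chi' y))).
    by rewrite !rmorphD; ring.
  by apply: Xadd; apply: chi'E.
- apply: uniq_val; first exact: T_mul.
  have -> : x * y - i (c (chi' x * chi' y)) =
      y * (x - i (c (chi' x))) + i (c (chi' x)) * (y - i (c (chi' y))).
    by rewrite !rmorphM; ring.
  by apply: Xadd; apply: Xmul => //; apply: chi'E.
- apply: uniq_val; first exact: T_i.
  by rewrite -rmorphB; apply: Xker; rewrite rmorphB chi_c subrr.
Qed.

End LyingOver.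

(** * Thin sets and power series *)

Section Thin.

Variables (k : closedFieldType) (W : lmodType k).
Hypothesis k_char : [pchar k] =i pred0.

Lemma fresh_scalar (s : seq k) : exists x, x \notin s.
Proof.
apply: contrapT => nex; pose t := [seq (m%:R : k) | m <- iota 0 (size s).+1].
have /uniq_leq_size sub : uniq t.
  rewrite map_inj_in_uniq ?iota_uniq // => a b _ _ ab.
  wlog le_ab : a b ab / (a <= b)%N.
    by move=> wl; case/orP: (leq_total a b) => /wl //; [apply | move->].
  apply/eqP; rewrite eqn_leq le_ab /= -subn_eq0 -((pcharf0P k).1 k_char).
  by rewrite natrB // ab subrr.
have : (size t <= size s)%N.
  apply: sub => x _; apply: contrapT => /negP nx; apply: nex.
  by exists x.
by rewrite size_map size_iota ltnn.
Qed.

(** Stands in for closedness: a line through a point outside Z meets Z finitely often. With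
    [thin_avoid] this replaces the irreducibility of affine space. *)
Definition thin (Z : W -> Prop) : Prop :=
  forall p q, ~ Z q -> exists s : seq k, forall t, Z (p + t *: (q - p)) -> t \in s.

Lemma thin_avoid (I : finType) (Z : I -> W -> Prop) :
  (forall i, thin (Z i)) -> (forall i, exists q, ~ Z i q) ->
  exists q, forall i, ~ Z i q.
Proof.
move=> Zthin Zproper.
suff /(_ (enum I)) [q qP] : forall s : seq I, exists q, forall i, i \in s -> ~ Z i q.
  by exists q => i; apply: qP; rewrite mem_enum.
elim=> [|i s [p pP]]; first by exists 0.
have [q qZ] := Zproper i.
have [s0 s0P] := Zthin i p q qZ.
(* For the sets handled earlier the point known to lie outside is [p], so the line is read from [q]
   to [p], which exchanges [t] and [1 - t]. *)
have other j : exists r : seq k, j \in s -> forall t, Z j (p + t *: (q - p)) -> t \in r.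
  have [js|] := boolP (j \in s); last by exists [::].
  have [r rP] := Zthin j q p (pP j js).
  exists [seq 1 - t | t <- r] => _ t Zt; apply/mapP; exists (1 - t); last by ring.
  apply: rP; rewrite (_ : q + _ = p + t *: (q - p)) //.
  by rewrite scalerBl scale1r addrA [q + (p - q)]addrC subrK -scalerN opprB.
have [r rP] := choice other.
have [t] := fresh_scalar (s0 ++ flatten [seq r j | j <- s]).
rewrite mem_cat negb_or => /andP[ts0 tr]; exists (p + t *: (q - p)) => j.
rewrite inE => /predU1P[->|js Zj]; first by move/s0P; rewrite (negbTE ts0).
by case/flatten_mapP: tr; exists j => //; apply: rP Zj.
Qed.

Lemma thin_subspace (Z : W -> Prop) :
  (forall a b x y, Z x -> Z y -> Z (a *: x + b *: y)) -> thin Z.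
Proof.
move=> Zlin p q nZq.
have [[t0 Zt0]|nex] := pselect (exists t, Z (p + t *: (q - p))); last first.
  by exists [::] => t Zt; case: nex; exists t.
exists [:: t0] => t Zt; rewrite inE; apply: contra_notT nZq => tt0.
have d0 : t - t0 != 0 by rewrite subr_eq0.
(* The point [q] of parameter 1 as an affine combination of the points of parameters [t] and
   [t0]. *)
have -> : q = ((1 - t0) / (t - t0)) *: (p + t *: (q - p))
            + ((t - 1) / (t - t0)) *: (p + t0 *: (q - p)); last exact: Zlin.
rewrite !(scalerDr _ p) !scalerA addrACA -!scalerDl.
have -> : (1 - t0) / (t - t0) + (t - 1) / (t - t0) = 1 by field.
have -> : (1 - t0) / (t - t0) * t + (t - 1) / (t - t0) * t0 = 1 by field.
by rewrite !scale1r subrKC.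
Qed.

(** Polynomiality along lines is all that thinness requires, and it is easy to check for functions
    such as Taylor coefficients that are not given as polynomials. *)
Definition line_poly (f : W -> k) : Prop :=
  forall p q, exists r : {poly k}, forall t, f (p + t *: (q - p)) = r.[t].

Lemma thin_line_poly f : line_poly f -> thin (fun x => f x = 0).
Proof.
move=> fpoly p q fq; have [r rE] := fpoly p q.
have r0 : r != 0.
  by apply: contra_notN fq => /eqP r0; have := rE 1; rewrite scale1r subrKC r0 horner0.
have [rs rsE] := closed_field_poly_normal r.
exists rs => t /eqP; rewrite rE -[_ == 0]/(root r t) rsE rootZ ?lead_coef_eq0 //.
by rewrite root_prod_XsubC.
Qed.

Lemma line_polyC c : line_poly (fun=> c).
Proof. by move=> p q; exists c%:P => t; rewrite hornerC. Qed.

Lemma line_polyD f g : line_poly f -> line_poly g -> line_poly (fun x => f x + g x).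
Proof.
move=> fP gP p q; have [[r rE] [s sE]] := (fP p q, gP p q).
by exists (r + s) => t; rewrite hornerD rE sE.
Qed.

Lemma line_polyM f g : line_poly f -> line_poly g -> line_poly (fun x => f x * g x).
Proof.
move=> fP gP p q; have [[r rE] [s sE]] := (fP p q, gP p q).
by exists (r * s) => t; rewrite hornerM rE sE.
Qed.

Lemma line_poly_eq f g : f =1 g -> line_poly f -> line_poly g.
Proof. by move=> /funext->. Qed.

Lemma line_poly_sum (I : Type) (r : seq I) (P : pred I) (F : I -> W -> k) :
  (forall i, line_poly (F i)) -> line_poly (fun x => \sum_(i <- r | P i) F i x).
Proof.
move=> FP; elim: r => [|i r IH].
  by apply: line_poly_eq (line_polyC 0) => x; rewrite big_nil.
case Pi: (P i).
  by apply: line_poly_eq (line_polyD (FP i) IH) => x; rewrite big_cons Pi.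
by apply: line_poly_eq IH => x; rewrite big_cons Pi.
Qed.

Lemma line_poly_prod (I : Type) (r : seq I) (P : pred I) (F : I -> W -> k) :
  (forall i, line_poly (F i)) -> line_poly (fun x => \prod_(i <- r | P i) F i x).
Proof.
move=> FP; elim: r => [|i r IH].
  by apply: line_poly_eq (line_polyC 1) => x; rewrite big_nil.
case Pi: (P i).
  by apply: line_poly_eq (line_polyM (FP i) IH) => x; rewrite big_cons Pi.
by apply: line_poly_eq IH => x; rewrite big_cons Pi.
Qed.

Lemma line_poly_linear (f : W -> k) :
  (forall a x y, f (a *: x + y) = a * f x + f y) -> line_poly f.
Proof.
move=> flin p q; exists ((f (q - p))%:P * 'X + (f p)%:P) => t.
by rewrite addrC flin !hornerE mulrC.
Qed.

End Thin.

(** * Polynomials as functions on affine space *)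

Section MpolyFunctions.

Variables (k : closedFieldType).
Hypothesis k_char : [pchar k] =i pred0.

Lemma line_poly_meval n (W : lmodType k) (c : W -> 'I_n -> k) (P : {mpoly k[n]}) :
  (forall i, line_poly (fun x => c x i)) -> line_poly (fun x => P.@[c x]).
Proof.
move=> cP; apply: line_poly_eq (fun x => esym (mevalE (c x) P)) _.
apply: line_poly_sum => m; apply: line_polyM; first exact: line_polyC.
apply: line_poly_prod => i; elim: (m i) => [|e IH]; first exact: line_polyC.
by apply: line_poly_eq (line_polyM (cP i) IH) => x; rewrite exprS.
Qed.

Lemma meval_all_eq0 n (P : {mpoly k[n]}) : (forall v, P.@[v] = 0) -> P = 0.
Proof.
elim: n P => [|n IH] P P0.
  rewrite [P]mpolyE big1 // => m _; have := P0 (fun=> 0).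
  have m0 (m' : 'X_{1..0}) : m' = 0%MM by apply/mnmP => -[].
  rewrite mevalE (m0 m).
  have [|] := boolP (0%MM \in msupp P); last by move/memN_msupp_eq0 => ->; rewrite scale0r.
  move=> P0s; rewrite (big_rem _ P0s) /= big_ord0 mulr1 big_seq big1 => [|m' m'r].
    by rewrite addr0 => ->; rewrite scale0r.
  by move: m'r; rewrite (m0 m') mem_rem_uniqF.
rewrite -(poly_of_mpolyK P); set Q := poly_of_mpoly _ _ P.
suff -> : Q = 0 by rewrite rmorph0.
apply/polyP => e; rewrite coef0; apply: IH => w.
suff : map_poly (meval w) Q = 0 by move/polyP/(_ e); rewrite coef_map coef0.
apply: contrapT => /eqP Qw0.
have [rs rsE] := closed_field_poly_normal (map_poly (meval w) Q).
have [t] := fresh_scalar k_char rs.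
rewrite -root_prod_XsubC -(@rootZ _ _ (lead_coef (map_poly (meval w) Q))) ?lead_coef_eq0 //.
rewrite -rsE => /negP; apply; apply/eqP.
pose v i := oapp w t (unlift ord_max i).
rewrite -[RHS](P0 v) -(poly_of_mpolyK P) -/Q /= /horner_eval -horner_map /= mevalXU.
rewrite {2}/v unlift_none; congr _.[_]; apply/polyP => d; rewrite !coef_map /=.
have : meval w =1 (meval v \o @mwiden n k).
  apply: mpoly_rmorph_ext => [c|i]; first by rewrite /= mwidenC !mevalC.
  by rewrite /= mwidenXU !mevalXU /v liftK.
by move=> ->.
Qed.

End MpolyFunctions.

Section PowerSeries.

Variable R : comNzRingType.

Definition pseries : Type := nat -> R.

HB.instance Definition _ := gen_eqMixin pseries.
HB.instance Definition _ := gen_choiceMixin pseries.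

Implicit Types f g h : pseries.

Definition ps_add f g : pseries := fun n => f n + g n.
Definition ps_opp f : pseries := fun n => - f n.
Definition ps_zero : pseries := fun=> 0.
Definition ps_one : pseries := fun n => (n == 0%N)%:R.
Definition ps_mul f g : pseries := fun n => \sum_(i < n.+1) f i * g (n - i)%N.

Let ps_addA : associative ps_add.
Proof. by move=> f g h; apply/funext => n; apply: addrA. Qed.
Let ps_addC : commutative ps_add.
Proof. by move=> f g; apply/funext => n; apply: addrC. Qed.
Let ps_add0 : left_id ps_zero ps_add.
Proof. by move=> f; apply/funext => n; apply: add0r. Qed.
Let ps_addN : left_inverse ps_zero ps_opp ps_add.
Proof. by move=> f; apply/funext => n; apply: addNr. Qed.

HB.instance Definition _ :=
  GRing.isZmodule.Build pseries ps_addA ps_addC ps_add0 ps_addN.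

(** Coefficient [n] of a product depends only on coefficients up to [n], so the ring laws are
    inherited from truncations. *)
Definition ps_trunc N f : {poly R} := \poly_(i < N) f i.

Lemma ps_mul_trunc N f g n : (n < N)%N ->
  ps_mul f g n = (ps_trunc N f * ps_trunc N g)`_n.
Proof.
move=> nN; rewrite coefM; apply: eq_bigr => i _; rewrite !coef_poly.
by rewrite (leq_ltn_trans (leq_ord i) nN) (leq_ltn_trans (leq_subr _ _) nN).
Qed.

Lemma coef_mul_trunc N (p q r : {poly R}) n : (n < N)%N ->
  (forall m, (m < N)%N -> p`_m = q`_m) -> (p * r)`_n = (q * r)`_n.
Proof.
move=> nN pq; rewrite !coefM; apply: eq_bigr => i _.
by rewrite pq // (leq_ltn_trans (leq_ord i) nN).
Qed.

Lemma ps_mulC : commutative ps_mul.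
Proof. by move=> f g; apply/funext => n; rewrite !(@ps_mul_trunc n.+1) // mulrC. Qed.

Let ps_mulA : associative ps_mul.
Proof.
have trunc_mul N f g m : (m < N)%N ->
    (ps_trunc N (ps_mul f g))`_m = (ps_trunc N f * ps_trunc N g)`_m.
  by move=> mN; rewrite coef_poly mN (ps_mul_trunc _ _ mN).
move=> f g h; apply/funext => n; rewrite !(@ps_mul_trunc n.+1) //.
rewrite [in LHS]mulrC [LHS](@coef_mul_trunc n.+1 _ (ps_trunc n.+1 g * ps_trunc n.+1 h)) //;
  last by move=> m; apply: trunc_mul.
rewrite [RHS](@coef_mul_trunc n.+1 _ (ps_trunc n.+1 f * ps_trunc n.+1 g)) //;
  last by move=> m; apply: trunc_mul.
by rewrite mulrC mulrA.
Qed.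

Let ps_mul1 : left_id ps_one ps_mul.
Proof.
move=> f; apply/funext => n; rewrite /ps_mul big_ord_recl /= subn0 mul1r big1 ?addr0 //.
by move=> i _; rewrite mul0r.
Qed.

Let ps_mulD : left_distributive ps_mul ps_add.
Proof.
move=> f g h; apply/funext => n; rewrite /ps_add /ps_mul -big_split.
by apply: eq_bigr => i _; rewrite mulrDl.
Qed.

Let ps_one_neq0 : ps_one != ps_zero.
Proof. by apply/eqP => /(congr1 (fun f => f 0%N)) /eqP; rewrite /= oner_eq0. Qed.

HB.instance Definition _ := GRing.Zmodule_isComNzRing.Build pseries
  ps_mulA ps_mulC ps_mul1 ps_mulD ps_one_neq0.

End PowerSeries.

Lemma pseriesDE (R : comNzRingType) (f g : pseries R) n : (f + g) n = f n + g n.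
Proof. by []. Qed.

Lemma pseriesME (R : comNzRingType) (f g : pseries R) n :
  (f * g) n = \sum_(i < n.+1) f i * g (n - i)%N.
Proof. by []. Qed.

(** The product of the lowest nonzero coefficients is a coefficient of the product. *)
Lemma pseries_mul_eq0 (R : idomainType) (f g : pseries R) :
  f * g = 0 -> f = 0 \/ g = 0.
Proof.
move=> fg0; apply: contrapT => /not_orP[f0 g0].
have ex (h : pseries R) : h <> 0 -> exists n, h n != 0.
  move=> h0; apply: contrapT => nex; apply: h0; apply/funext => n.
  by apply/eqP; apply: contrapT => /negP hn; apply: nex; exists n.
case: (ex_minnP (ex f f0)) => a fa amin; case: (ex_minnP (ex g g0)) => b gb bmin.
have lta : (a < (a + b).+1)%N by rewrite ltnS leq_addr.
have := congr1 (fun h => h (a + b)%N) fg0; rewrite pseriesME (bigD1 (Ordinal lta)) //=.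
rewrite addKn big1 ?addr0 => [/eqP|i ia].
  by rewrite mulf_eq0 (negbTE fa) (negbTE gb).
have [lti|gti|eqi] := ltngtP i a; last 1 first.
- by case/eqP: ia; apply: val_inj.
- case: (eqVneq (f i) 0) => [->|/amin]; first by rewrite mul0r.
  by rewrite leqNgt lti.
- case: (eqVneq (g (a + b - i)%N) 0) => [->|/bmin]; first by rewrite mulr0.
  by rewrite leq_subRL ?(leq_ord i) // leq_add2r leqNgt gti.
Qed.

Section PolyToPseries.

Variable R : comNzRingType.

Definition ps_of_poly (p : {poly R}) : pseries R := fun n => p`_n.

Lemma ps_of_poly_zmod_morphism : zmod_morphism ps_of_poly.
Proof. by move=> p q; apply/funext => n; rewrite /ps_of_poly coefB. Qed.

Lemma ps_of_poly_monoid_morphism : monoid_morphism ps_of_poly.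
Proof.
split=> [|p q]; apply/funext => n; first by rewrite /ps_of_poly coef1.
by rewrite /ps_of_poly coefM.
Qed.

HB.instance Definition _ :=
  GRing.isZmodMorphism.Build _ _ ps_of_poly ps_of_poly_zmod_morphism.
HB.instance Definition _ :=
  GRing.isMonoidMorphism.Build _ _ ps_of_poly ps_of_poly_monoid_morphism.

End PolyToPseries.

(** * Points with trivial stabiliser *)

Section MatrixRepresentation.

Variables (k : closedFieldType) (n : nat).
Hypothesis k_char : [pchar k] =i pred0.
Local Notation A := {mpoly k[n]}.
Local Notation V := 'cV[k]_n.

Definition evp (x : V) (P : A) : k := P.@[fun a => x a 0].

HB.instance Definition _ x :=
  GRing.RMorphism.copy (evp x) (meval (fun a => x a 0)).

Lemma evpC x c : evp x c%:MP = c.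
Proof. exact: mevalC. Qed.

Lemma evpX x a : evp x 'X_a = x a 0.
Proof. exact: mevalXU. Qed.

Lemma evpZ x c P : evp x (c *: P) = c * evp x P.
Proof. exact: mevalZ. Qed.

Lemma evp_ext P Q : (forall x, evp x P = evp x Q) -> P = Q.
Proof.
move=> PQ; apply/eqP; rewrite -subr_eq0; apply/eqP/(meval_all_eq0 k_char) => v.
rewrite mevalB; apply/eqP; rewrite subr_eq0; have := PQ (\col_a v a).
by rewrite /evp !(meval_eq _ (v2 := v)) => [->||] // a; rewrite mxE.
Qed.

Lemma evp_const P : (forall x y, evp x P = evp y P) -> P = (evp 0 P)%:MP.
Proof. by move=> PC; apply: evp_ext => x; rewrite evpC. Qed.

Lemma line_poly_evp P : line_poly (fun x => evp x P).
Proof.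
apply: line_poly_meval => a; apply: line_poly_linear => c x y.
by rewrite !mxE.
Qed.

Definition linear_form (c : 'rV[k]_n) : A := \sum_a c 0 a *: 'X_a.

Lemma evp_linear_form x c : evp x (linear_form c) = (c *m x) 0 0.
Proof. by rewrite rmorph_sum mxE; apply: eq_bigr => a _; rewrite /= evpZ evpX. Qed.

Definition mpoly_subst (M : 'M[k]_n) : {rmorphism A -> A} :=
  mmap (@mpolyC n k) (fun a => linear_form (row a M)).

Lemma evp_subst x M P : evp x (mpoly_subst M P) = evp (M *m x) P.
Proof.
apply: (@mpoly_rmorph_ext n k _ (evp x \o mpoly_subst M) (evp (M *m x))) => [c|a].
  by rewrite /= mmapC !evpC.
rewrite /= mmapX mmap1U evp_linear_form evpX -row_mul.
by rewrite mxE.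
Qed.

Variables (gT : finGroupType) (r : gT -> 'M[k]_n).
Hypothesis r1 : r 1%g = 1%:M.
Hypothesis rM : forall g h, r (g * h)%g = r g *m r h.
(** The absence of pseudo-reflections in matrix form: the image of [r g - 1] lies in no line, so the
    fixed space of [g] has codimension at least two. The case [w = 0] says that [r g] is not the
    identity. *)
Hypothesis r_codim : forall g, g != 1%g -> forall w : V,
  exists x, forall t, (r g - 1%:M) *m x != t *: w.

Lemma codim_neq0 g : g != 1%g -> r g - 1%:M != 0.
Proof.
move=> /r_codim/(_ 0)[x /(_ 0)]; apply: contraNneq => ->.
by rewrite mul0mx scaler0.
Qed.

(** Functions are pulled back, so products are reversed in [pactM], which is the convention of
    [actM] above. *)
Definition pact (g : gT) : {rmorphism A -> A} := mpoly_subst (r g).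

Arguments pact : simpl never.

Lemma evp_pact x g P : evp x (pact g P) = evp (r g *m x) P.
Proof. exact: evp_subst. Qed.

Lemma pact1 P : pact 1%g P = P.
Proof. by apply: evp_ext => x; rewrite evp_pact r1 mul1mx. Qed.

Lemma pactM g h P : pact (g * h)%g P = pact h (pact g P).
Proof. by apply: evp_ext => x; rewrite evp_pact rM -mulmxA -evp_pact -evp_pact. Qed.

Lemma pact_linear_form g c : pact g (linear_form c) = linear_form (c *m r g).
Proof. by apply: evp_ext => x; rewrite evp_pact !evp_linear_form mulmxA. Qed.

Definition free_point (x : V) : Prop := forall g, g != 1%g -> r g *m x <> x.

Lemma free_orbit_inj x g h : free_point x -> r g *m x = r h *m x -> g = h.
Proof.
move=> xfree gh; apply/eqP; rewrite -[g == h](inj_eq (mulgI h^-1%g)) mulVg.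
apply: contraT => /xfree; case.
by rewrite rM -mulmxA gh mulmxA -rM mulVg r1 mul1mx.
Qed.

Lemma exists_free_point : exists x, free_point x.
Proof.
pose Z g (x : V) := g != 1%g /\ r g *m x = x.
have [g|g|x xP] := @thin_avoid _ _ k_char _ Z; last first.
- by exists x => g g1 gx; apply: (xP g).
- have [->|g1] := eqVneq g 1%g; first by exists 0 => -[]; rewrite eqxx.
  have := codim_neq0 g1.
  apply: contraNP => nex; apply/eqP/matrixP => a b.
  have : r g *m delta_mx b 0 = delta_mx b 0 :> V.
    by apply: contrapT => gb; apply: nex; exists (delta_mx b 0) => -[].
  move/eqP; rewrite -subr_eq0 -{2}[delta_mx b 0]mul1mx -mulmxBl -colE => /eqP/matrixP.
  by move/(_ a 0); rewrite !mxE.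
- apply: thin_subspace => a b x y [g1 gx] [_ gy]; split=> //.
  by rewrite mulmxDr -!scalemxAr gx gy.
Qed.

(* A direction u in which P varies, then a line parallel to u missing every
   fixed space: such lines exist as the fixed spaces have codimension >= 2. *)
Lemma nonconstant_free_zero P x0 y0 :
  evp x0 P != evp y0 P -> exists2 x, free_point x & evp x P = 0.
Proof.
move=> xy; pose u := y0 - x0.
pose Z (o : option gT) (p : V) := if o is Some g
  then g != 1%g /\ exists t, (r g - 1%:M) *m (p + t *: u) = 0
  else evp (p + u) P - evp p P = 0.
have [[g|]|[g|]|p pP] := @thin_avoid _ _ k_char _ Z.
- apply: thin_subspace => a b x y [g1 [t tx]] [_ [s sy]]; split=> //.
  exists (a * t + b * s); rewrite scalerDl -!scalerA addrACA -!scalerDr.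
  by rewrite mulmxDr -!scalemxAr tx sy !scaler0 addr0.
- apply: thin_line_poly => p q.
  have [f fE] := line_poly_evp P (p + u) (q + u).
  have [h hE] := line_poly_evp P p q.
  exists (f - h) => t; rewrite hornerD hornerN -fE -hE; congr (evp _ P - _).
  by rewrite opprD [q + u + _]addrACA [u + _]addrC addNr addr0 addrAC.
- have [->|g1] := eqVneq g 1%g; first by exists 0 => -[]; rewrite eqxx.
  have [x xP] := r_codim g1 ((r g - 1%:M) *m u).
  exists x => -[_ [t tx]]; case/eqP: (xP (- t)).
  by apply/eqP; rewrite scaleNr -addr_eq0 scalemxAr -mulmxDr tx.
- by exists x0; rewrite /Z /u subrKC; apply/eqP; rewrite subr_eq0 eq_sym.
have [f fE] := line_poly_evp P p (p + u).
have fE' t : evp (p + t *: u) P = f.[t] by rewrite -fE addrAC subrr add0r.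
have /closed_rootP[t /eqP ft] : size f != 1%N.
  apply: contra_notN (pP None) => /eqP f1 /=.
  have := fE' 0; have := fE' 1; rewrite scale1r scale0r addr0 => -> ->.
  have -> : f = (f`_0)%:P by apply: size1_polyC; rewrite f1.
  by rewrite !hornerC subrr.
exists (p + t *: u); last by rewrite fE'.
move=> g g1 gx; apply: (pP (Some g)); split=> //; exists t.
by rewrite mulmxBl gx mul1mx subrr.
Qed.

(* For each c and lam these n + 1 forms span the space of all linear forms. *)
Definition pencil (c : 'rV[k]_n) (lam : k) (o : option 'I_n) : A :=
  if o is Some a then 'X_a + lam *: linear_form c else linear_form c.

(** A common multiple of the differents of all forms of the pencil: it clears denominators for every
    coordinate at once. *)
Definition multiplier (c : 'rV[k]_n) (lam : k) : A :=
  \prod_o orbit_diff pact (pencil c lam o).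

Lemma pencil_separates x : free_point x -> exists c lam, forall o g h,
  g != h -> evp (r g *m x) (pencil c lam o) != evp (r h *m x) (pencil c lam o).
Proof.
move=> xfree.
pose w (p : gT * gT) := r p.1 *m x - r p.2 *m x.
have w0 p : p.1 != p.2 -> w p != 0.
  by apply: contraNneq => /eqP; rewrite subr_eq0 => /eqP/(free_orbit_inj xfree) ->.
pose Z (p : gT * gT) (c : 'rV[k]_n) := p.1 != p.2 /\ (c *m w p) 0 0 = 0.
have [p|p|c cP] := @thin_avoid _ _ k_char _ Z.
- apply: thin_subspace => a b c d [p12 cp] [_ dp]; split=> //.
  by rewrite mulmxDl -!scalemxAl 2!mxE cp mxE dp !mulr0 addr0.
- have [p12|p12] := eqVneq p.1 p.2; first by exists 0 => -[]; rewrite p12 eqxx.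
  have /cV0Pn[a wa] := w0 p p12.
  exists (delta_mx 0 a) => -[_]; rewrite -rowE mxE => /eqP.
  by rewrite (negbTE wa).
(* The excluded scalars are those for which some form ['X_a + lam c] takes equal values at two
   points of the orbit. Pairs of equal elements contribute only the value 0. *)
have [lam lamP] := fresh_scalar k_char
  [seq - (w q.1 q.2 0) / (c *m w q.1) 0 0 | q : (gT * gT) * 'I_n].
exists c, lam => o g h gh.
have cw0 : (c *m w (g, h)) 0 0 != 0 by apply/eqP => E; apply: (cP (g, h)).
have wE : (c *m w (g, h)) 0 0 = (c *m (r g *m x)) 0 0 - (c *m (r h *m x)) 0 0.
  by rewrite mulmxBr !mxE.
case: o => [a|] /=; last by rewrite !evp_linear_form -subr_eq0 -wE.
apply: contraNneq lamP => /eqP; rewrite !rmorphD /= !evpX !evpZ !evp_linear_form.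
rewrite -subr_eq0 opprD addrACA -mulrBr -wE => /eqP E.
apply/fintype.imageP; exists ((g, h), a) => //=.
apply: (mulIf cw0); rewrite divfK //; apply/eqP; rewrite -addr_eq0 addrC.
by apply/eqP; rewrite -[RHS]E; congr (_ + _); rewrite !mxE.
Qed.

Lemma multiplier_nonvanishing x : free_point x ->
  exists c lam, forall h, evp (r h *m x) (multiplier c lam) != 0.
Proof.
move=> /pencil_separates[c [lam sep]]; exists c, lam => h.
rewrite rmorph_prod; apply/prodf_neq0 => o _; rewrite rmorph_prod.
apply/prodf_neq0 => g g1; rewrite /= rmorphB /= subr_eq0 evp_pact mulmxA -rM.
apply: sep; apply: contraNneq g1 => /eqP; rewrite -{1}[h]mul1g => /eqP/mulIg.
by move<-.
Qed.

Lemma nonunit_nonconstant (P : A) : P != 0 -> P \isn't a GRing.unit ->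
  exists x y, evp x P != evp y P.
Proof.
move=> P0 Pu; apply: contrapT => nex.
have PC : P = (evp 0 P)%:MP.
  apply: evp_const => x y; apply/eqP; apply: contrapT => /negP xy.
  by apply: nex; exists x, y.
have e0 : evp 0 P != 0 by apply: contraNneq P0 => e0; rewrite PC e0 mpolyC0.
case/negP: Pu; apply/unitrP; exists (evp 0 P)^-1%:MP; rewrite PC evpC.
by rewrite -!mpolyCM mulVf // mulfV.
Qed.

(** A prime has a zero with trivial stabiliser, and some multiplier does not vanish there. *)
Lemma multiplier_coprime (p : A) : prime_elt p ->
  exists c lam, ~ divides p (multiplier c lam).
Proof.
case=> p0 pu _; have [x [y xy]] := nonunit_nonconstant p0 pu.
have [v vfree vp] := nonconstant_free_zero xy.
have [c [lam cP]] := multiplier_nonvanishing vfree.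
exists c, lam => -[z zE]; have := cP 1%g.
by rewrite r1 mul1mx zE rmorphM /= vp mulr0 eqxx.
Qed.

Variables (B : comNzRingType) (j : {rmorphism B -> A}) (cB : k -> B).
Hypothesis j_inj : injective j.
Hypothesis pact_j : forall g b, pact g (j b) = j b.
Hypothesis j_surj : forall P, (forall g, pact g P = P) -> exists b, j b = P.
Hypothesis j_cB : forall x, j (cB x) = x%:MP.
Variables (s s' : {rmorphism B -> B}).
Hypothesis sK : cancel s s'.
Hypothesis s'K : cancel s' s.
Hypothesis s_cB : forall x, s (cB x) = cB x.

Lemma norm_invariant P : exists b, j b = orbit_norm pact P.
Proof. by apply: j_surj => g; apply: act_orbit_norm pactM _ _. Qed.

(* A prime dividing every d would, after taking norms and applying the inverse
   of s, give a nonconstant invariant vanishing only at non-free points. *)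
Lemma twisted_multiplier_coprime (p : A) : prime_elt p ->
  exists c lam, forall b, j b = orbit_norm pact (multiplier c lam) ->
    ~ divides p (j (s b)).
Proof.
case=> p0 pu _; have [b bE] := norm_invariant p.
have Np0 : j b != 0 by rewrite bE (orbit_norm_eq0 pact1 pactM).
have Npu : j b \isn't a GRing.unit.
  apply: contraNN pu; rewrite bE /orbit_norm (bigD1 1%g) //= pact1 unitrM.
  by case/andP.
have [x [y xy]] : exists x y, evp x (j (s' b)) != evp y (j (s' b)).
  apply: nonunit_nonconstant.
    by apply: contraNneq Np0; rewrite -(rmorph0 j) => /j_inj s'b0;
      rewrite -(s'K b) s'b0 !rmorph0.
  apply: contraNN Npu => /andP[/eqP cE cu].
  have : s' b = cB (j (s' b))@_0 by apply: j_inj; rewrite j_cB.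
  move/(congr1 s); rewrite s'K s_cB => ->; rewrite j_cB.
  by apply: (rmorph_unit (@mpolyC n k)).
have [v vfree vb] := nonconstant_free_zero xy.
have [c [lam cP]] := multiplier_nonvanishing vfree.
exists c, lam => e eE [z zE].
have [z' z'E] := norm_invariant z.
(* The norm of [j (s e) = z * p]: its left side is invariant, so its norm is a power. Applying [s']
   makes a power of [e] vanish at [v], where the norm of the multiplier is nonzero. *)
have eb : s e ^+ #|gT| = z' * b.
  apply: j_inj; rewrite rmorphXn rmorphM bE z'E /orbit_norm -big_split /=.
  rewrite -prodr_const; apply: eq_big => // g _.
  by rewrite -rmorphM -zE pact_j.
have : evp v (j e) ^+ #|gT| = 0.
  rewrite -rmorphXn -rmorphXn -(sK (e ^+ _)) rmorphXn eb !rmorphM /= vb.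
  by rewrite mulr0.
move/eqP; rewrite expf_eq0 => /andP[_]; apply/negP.
rewrite eE rmorph_prod; apply/prodf_neq0 => g _.
by rewrite /= evp_pact.
Qed.


End MatrixRepresentation.

(** * Purity and the formal lift *)

Lemma deriv_orbit_poly (gT : finGroupType) (A : idomainType)
    (act : gT -> {rmorphism A -> A}) (l : A) :
  (forall a, act 1%g a = a) -> (orbit_poly act l)^`().[l] = orbit_diff act l.
Proof.
move=> act1; rewrite /orbit_poly (bigD1 1%g) //= act1 derivM derivXsubC mul1r.
rewrite hornerD hornerM hornerXsubC subrr mul0r addr0 horner_prod.
by apply: eq_bigr => g _; rewrite hornerXsubC.
Qed.

Lemma derivation_mpoly (R : comNzRingType) (n : nat) (S : comNzRingType)
    (f : {rmorphism {mpoly R[n]} -> S}) (D : {mpoly R[n]} -> S) P :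
  derivation_along f D -> (forall c, D c%:MP = 0) ->
  D P = \sum_a f P^`M(a) * D 'X_a.
Proof.
move=> dD DC; pose D' Q := D Q - \sum_a f Q^`M(a) * D 'X_a.
have D'M Q Q' : D' Q = 0 -> D' Q' = 0 -> D' (Q * Q') = 0.
  move=> /eqP; rewrite subr_eq0 => /eqP QE /eqP; rewrite subr_eq0 => /eqP QE'.
  rewrite /D' dD.2 QE QE' mulr_suml mulr_sumr -big_split -sumrB big1 //= => a _.
  by rewrite mderivM rmorphD !rmorphM /=; ring.
have D'C c : D' c%:MP = 0.
  rewrite /D' DC big1 ?subr0 // => a _.
  by rewrite mderivC rmorph0 mul0r.
have D'X a : D' 'X_a = 0.
  rewrite /D' (bigD1 a) //= big1 => [|b ba].
    rewrite mderivX mnm1E eqxx scale1r addr0.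
    have -> : ('X_[U_(a) - U_(a)] : {mpoly R[n]}) = 1.
      by rewrite -mpolyX0; congr ('X_[ _]); apply/mnmP => c; rewrite mnmBE subnn mnm0E.
    by rewrite rmorph1 mul1r subrr.
  by rewrite mderivX mnm1E eq_sym (negbTE ba) scale0r rmorph0 mul0r.
suff : D' P = 0 by move/eqP; rewrite subr_eq0 => /eqP.
elim/mpolyind: P => [|c m Q _ _ IH]; first by rewrite -mpolyC0 D'C.
have D'D Q1 Q2 : D' (Q1 + Q2) = D' Q1 + D' Q2.
  rewrite /D' dD.1 addrACA -opprD -big_split; congr (_ - _).
  by apply: eq_bigr => a _; rewrite /= mderivD rmorphD mulrDl.
rewrite D'D IH addr0 -mul_mpolyC; apply: (D'M) => //; rewrite mpolyXE_id.
elim/big_ind: _ => [|x y|a _]; [by rewrite -mpolyC1 D'C|exact: D'M|].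
elim: (m a) => [|e IHe]; first by rewrite expr0 -mpolyC1 D'C.
by rewrite exprS; apply: (D'M).
Qed.

(** * Derivations on the compositum of two copies of A, and integrality *)

Section Compositum.

Variables (k : closedFieldType) (n : nat).
Hypothesis k_char : [pchar k] =i pred0.
Local Notation A := {mpoly k[n]}.
Local Notation V := 'cV[k]_n.
Variables (gT : finGroupType) (r : gT -> 'M[k]_n).
Hypothesis r1 : r 1%g = 1%:M.
Hypothesis rM : forall g h, r (g * h)%g = r g *m r h.
Hypothesis r_codim : forall g, g != 1%g -> forall w : V,
  exists x, forall t, (r g - 1%:M) *m x != t *: w.
Variables (B : comNzRingType) (j : {rmorphism B -> A}) (cB : k -> B).
Hypothesis j_inj : injective j.
Hypothesis pact_j : forall g b, pact r g (j b) = j b.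
Hypothesis j_surj : forall P, (forall g, pact r g P = P) -> exists b, j b = P.
Hypothesis j_cB : forall x, j (cB x) = x%:MP.
Variables (s s' : {rmorphism B -> B}).
Hypothesis sK : cancel s s'.
Hypothesis s'K : cancel s' s.
Hypothesis s_cB : forall x, s (cB x) = cB x.
Variables (E : fieldType) (i phi : {rmorphism A -> E}) (D : 'I_n -> E -> E).
Hypothesis i_inj : injective i.
Hypothesis phi_j : forall b, phi (j b) = i (j (s b)).
Hypothesis D_der : forall a, derivation_along idfun (D a).
Hypothesis D_i : forall a P, D a (i P) = i P^`M(a).

Local Notation act := (pact r).
Let act1 := pact1 k_char r1.
Let actM := pactM k_char rM.

Inductive joint : E -> Prop :=
| joint_i P : joint (i P)
| joint_phi P : joint (phi P)
| joint_add x y : joint x -> joint y -> joint (x + y)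
| joint_mul x y : joint x -> joint y -> joint (x * y).

Lemma phiC x : phi x%:MP = i x%:MP.
Proof. by rewrite -j_cB phi_j s_cB. Qed.

Lemma joint_opp x : joint x -> joint (- x).
Proof.
move=> jx; rewrite -mulN1r -(rmorph1 i) -rmorphN; apply: joint_mul => //.
exact: joint_i.
Qed.

Lemma joint0 : joint 0. Proof. by rewrite -(rmorph0 i); apply: joint_i. Qed.
Lemma joint1 : joint 1. Proof. by rewrite -(rmorph1 i); apply: joint_i. Qed.

Lemma joint_exp x e : joint x -> joint (x ^+ e).
Proof.
move=> jx; elim: e => [|e IH]; first exact: joint1.
by rewrite exprS; apply: joint_mul.
Qed.

Lemma joint_sum (I : Type) (q : seq I) (P : pred I) (F : I -> E) :
  (forall l, P l -> joint (F l)) -> joint (\sum_(l <- q | P l) F l).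
Proof. by move=> jF; elim/big_ind: _ => //; [exact: joint0 | exact: joint_add]. Qed.

(** [phi P] is a root of the orbit polynomial of [P] with coefficients moved by [s], which is monic
    over [i(A)]. *)
Lemma joint_integral z : joint z -> integralOver i z.
Proof.
elim=> [P|P|x y _ ix _ iy|x y _ ix _ iy].
- exact: integral_id.
- have [q qmon qP] := integral_invariants act1 actM j_inj j_surj P.
  exists (map_poly (j \o s) q); first exact: monic_map.
  rewrite -map_poly_comp (eq_map_poly (g := phi \o j)) => [|b]; last by rewrite /= phi_j.
  by rewrite map_poly_comp rmorph_root.
- exact: integral_add.
- exact: integral_mul.
Qed.

Lemma D_const a x : D a (i x%:MP) = 0.
Proof. by rewrite D_i mderivC rmorph0. Qed.

Lemma orbit_poly_lift l : exists Q, map_poly j Q = orbit_poly act l.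
Proof. by apply: invariant_poly_lift j_surj _ _ => g; apply: act_orbit_poly. Qed.

(** Differentiate the equation of [phi l]: its coefficients lie in [i(A)], which [D a] preserves,
    and the coefficient of [D a (phi l)] is the different. *)
Lemma joint_D_phi_orbit_diff a l : joint (phi (orbit_diff act l) * D a (phi l)).
Proof.
have [Q QE] := orbit_poly_lift l.
pose Q' := map_poly (j \o s) Q.
have Q'E : map_poly i Q' = map_poly phi (orbit_poly act l).
  rewrite -QE /Q' -!map_poly_comp; apply: eq_map_poly => b.
  by rewrite /= phi_j.
have := @poly_derivation_horner A E i (D a \o i) _ (D a) (phi l) Q' (D_der a) _.
rewrite Q'E horner_map (eqP (root_orbit_poly act1 l)) rmorph0.
rewrite (derivation0 (D_der a)) /poly_derivation Q'E deriv_map horner_map.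
rewrite deriv_orbit_poly // => /(_ _ _)/esym/eqP.
rewrite addr_eq0 => H.
have {H}/eqP : (map_poly (D a \o i) Q').[phi l] == - (phi (orbit_diff act l) * D a (phi l)).
  apply: H => //; split=> x y /=; first by rewrite rmorphD (D_der a).1.
  by rewrite rmorphM (D_der a).2.
move/(congr1 -%R); rewrite opprK => <-; apply: joint_opp; rewrite horner_coef.
apply: joint_sum => m _; apply: joint_mul; last exact/joint_exp/joint_phi.
rewrite coef_map_id0 /= ?D_i; first exact: joint_i.
by rewrite mderiv0 rmorph0.
Qed.

(** Stated for any linear [y], as it serves both for [D a] on [phi(A)] and for the rows of the
    inverse Jacobian on [i(A)]. *)
Lemma joint_from_pencil (m : E) (y : A -> E) c lam : joint m ->
  (forall P Q, y (P + Q) = y P + y Q) ->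
  (forall x P, y (x *: P) = i x%:MP * y P) ->
  (forall o, joint (m * y (pencil c lam o))) ->
  forall b, joint (m * y 'X_b).
Proof.
move=> jm yD yZ jp b; have := jp (Some b); rewrite /= yD yZ => jb.
rewrite -[m * y 'X_b](addrK (m * (i lam%:MP * y (linear_form c)))) -mulrDr.
apply: joint_add => //; apply: joint_opp; rewrite mulrCA.
by apply: joint_mul; [apply: joint_i | apply: (jp None)].
Qed.

Lemma joint_D_phi_multiplier a c lam P :
  joint (phi (multiplier r c lam) * D a (phi P)).
Proof.
have jX b : joint (phi (multiplier r c lam) * D a (phi 'X_b)).
  apply: (@joint_from_pencil _ (fun P => D a (phi P)) c lam).
  - exact: joint_phi.
  - by move=> Q R; rewrite rmorphD (D_der a).1.
  - move=> x Q; rewrite -mul_mpolyC rmorphM (D_der a).2 phiC D_const mul0r.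
    by rewrite add0r.
  - move=> o; rewrite /multiplier (bigD1 o) //= rmorphM mulrAC.
    by apply: joint_mul; [apply: joint_D_phi_orbit_diff | apply: joint_phi].
have -> : D a (phi P) = \sum_b phi P^`M(b) * D a (phi 'X_b).
  apply: (@derivation_mpoly _ _ _ phi (D a \o phi) P).
    split=> Q R /=; first by rewrite rmorphD (D_der a).1.
    by rewrite rmorphM (D_der a).2.
  by move=> x /=; rewrite phiC D_const.
rewrite mulr_sumr; apply: joint_sum => b _; rewrite mulrCA.
by apply: joint_mul; [apply: joint_phi | apply: jX].
Qed.

(** The natural denominator [phi (multiplier r c lam)] need not lie in [i(A)]. The norm of the
    multiplier is invariant, so [phi] sends it to [i d], which is a multiple of the natural
    denominator within [joint]. *)
Definition twisted_multiplier (d : A) : Prop :=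
  exists c lam b, j b = orbit_norm act (multiplier r c lam) /\ d = j (s b).

Lemma joint_D d a z : twisted_multiplier d -> joint z -> joint (i d * D a z).
Proof.
case=> c [lam [b [bE ->]]]; elim=> [P|P|x y jx IHx jy IHy|x y jx IHx jy IHy].
- by rewrite D_i; apply: joint_mul; apply: joint_i.
- rewrite -phi_j bE /orbit_norm (bigD1 1%g) //= act1 rmorphM mulrAC.
  by apply: joint_mul; [apply: joint_D_phi_multiplier | apply: joint_phi].
- by rewrite (D_der a).1 mulrDr; apply: joint_add.
- rewrite (D_der a).2 /= mulrDr mulrA [i _ * (x * _)]mulrCA.
  by apply: joint_add; apply: joint_mul.
Qed.

(* The common zeros of the twisted multipliers have codimension at least two, so
   tame elements are those regular in codimension one. *)
Definition tame (z : E) : Prop :=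
  forall d, twisted_multiplier d -> exists e, joint (i (d ^+ e) * z).

Lemma joint_tame z : joint z -> tame z.
Proof. by move=> jz d _; exists 0%N; rewrite expr0 rmorph1 mul1r. Qed.

Lemma tame_add x y : tame x -> tame y -> tame (x + y).
Proof.
move=> tx ty d td; have [[e ex] [f fy]] := (tx d td, ty d td).
exists (e + f)%N; rewrite exprD rmorphM mulrDr; apply: joint_add.
  by rewrite mulrAC mulrC; apply: joint_mul => //; apply: joint_i.
by rewrite -mulrA; apply: joint_mul => //; apply: joint_i.
Qed.

Lemma tame_mul x y : tame x -> tame y -> tame (x * y).
Proof.
move=> tx ty d td; have [[e ex] [f fy]] := (tx d td, ty d td).
by exists (e + f)%N; rewrite exprD rmorphM mulrACA; apply: joint_mul.
Qed.

Lemma tame_D a z : tame z -> tame (D a z).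
Proof.
move=> tz d td; have [e jz] := tz d td; have jD := joint_D a td jz.
(* Quotient rule: [d^(2e+1) D z] equals [d^e] times [d D(d^e z)], minus [d D(d^e)] times [d^e z]. *)
exists (e + e).+1; move: jD; rewrite (D_der a).2 D_i /= => jD.
rewrite (_ : _ * _ = i (d ^+ e) * (i d * (i (d ^+ e)^`M(a) * z + i (d ^+ e) * D a z))
  - i d * i (d ^+ e)^`M(a) * (i (d ^+ e) * z)); last first.
  by rewrite exprS exprD !rmorphM; ring.
apply: joint_add; first by apply: joint_mul => //; apply: joint_i.
by apply/joint_opp/joint_mul => //; apply: joint_mul; apply: joint_i.
Qed.

Lemma factorial_A : factorial_dom A.
Proof. exact/factorial_mpoly/factorial_field. Qed.

Lemma exists_multiplier_neq0 : exists c lam, multiplier r c lam != 0.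
Proof.
have [x xfree] := exists_free_point k_char r_codim.
have [c [lam cP]] := multiplier_nonvanishing k_char r1 rM xfree.
exists c, lam; apply: contraNneq (cP 1%g) => ->.
by rewrite rmorph0.
Qed.

(** The purity step: elements regular in codimension one are integral. So [tame] is a ring of
    integral elements stable under every [D a], to which the evaluation at the origin applies. *)
Lemma tame_integral z : tame z -> integralOver i z.
Proof.
move=> tz; apply: (@integral_by_coprime_multipliers _ _ _ twisted_multiplier _ factorial_A i_inj).
- have [c [lam m0]] := exists_multiplier_neq0.
  have [b bE] := norm_invariant k_char rM j_surj (multiplier r c lam).
  exists (j (s b)); first by exists c, lam, b.
  apply: contraNneq m0; rewrite -(orbit_norm_eq0 act1 actM) -bE.
  rewrite -(rmorph0 j) => /j_inj sb0; rewrite -(sK b) sb0 rmorph0.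
  by rewrite rmorph0.
- move=> p pp.
  have [c [lam cP]] := twisted_multiplier_coprime k_char r1 rM r_codim j_inj
    pact_j j_surj j_cB sK s'K s_cB pp.
  have [b bE] := norm_invariant k_char rM j_surj (multiplier r c lam).
  by exists (j (s b)); [exists c, lam, b | apply: cP].
- by move=> d td; have [e je] := tz d td; exists e; apply: joint_integral.
Qed.


(** The argument of [joint_D_phi_orbit_diff] with [i] and [phi] exchanged: through [s'], the
    invariant coefficients of the orbit polynomial of [l] are read in [phi(A)]. [Q] precedes [delta]
    so that relations for several derivations can be combined. *)
Lemma derivation_orbit_relation l : exists Q : {poly B}, forall delta : E -> E,
  derivation_along idfun delta ->
  i (orbit_diff act l) * delta (i l)
    = - \sum_(m < size Q) delta (phi (j Q`_m)) * i l ^+ m.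
Proof.
have [Q QE] := orbit_poly_lift l; exists (map_poly s' Q) => delta dd.
have didd : derivation_along i (delta \o i).
  by split=> x y /=; rewrite ?rmorphD ?rmorphM ?dd.1 ?dd.2.
have := @poly_derivation_horner A E i (delta \o i) didd delta (i l) (map_poly j Q) dd
  (fun=> erefl).
rewrite QE horner_map (eqP (root_orbit_poly act1 l)) rmorph0 (derivation0 dd).
rewrite /poly_derivation deriv_map horner_map deriv_orbit_poly // => /esym/eqP.
rewrite addrC addr_eq0 => /eqP ->; congr (- _); rewrite -QE.
rewrite (size_map_inj_poly (can_inj s'K)) ?rmorph0 // (@horner_coef_wide _ (size Q)).
  apply: eq_bigr => m _; rewrite coef_map phi_j s'K coef_map_id0 ?coef_map //.
  exact: derivation0 didd.
by rewrite (leq_trans (size_poly _ _)) // size_poly.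
Qed.

Lemma phi_derivation_eq0 (delta : E -> E) : derivation_along idfun delta ->
  (forall x, delta (i x%:MP) = 0) -> (forall b, delta (phi 'X_b) = 0) ->
  forall P, delta (phi P) = 0.
Proof.
move=> dd dC dX P; rewrite -[LHS]/((delta \o phi) P) (@derivation_mpoly _ _ _ phi (delta \o phi)).
- by rewrite big1 // => b _; rewrite /= dX mulr0.
- by split=> x y /=; rewrite ?rmorphD ?rmorphM ?dd.1 ?dd.2.
- by move=> x; rewrite /= phiC dC.
Qed.

Definition jac : 'M[E]_n := \matrix_(a, b) D a (phi 'X_b).

Lemma D_i_X a b : D a (i 'X_b) = (a == b)%:R.
Proof.
rewrite D_i mderivX mnm1E eq_sym; case: eqP => [->|_]; last by rewrite scale0r rmorph0.
rewrite scale1r (_ : 'X_[_] = 1) ?rmorph1 // -mpolyX0; congr ('X_[ _]).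
by apply/mnmP => c; rewrite mnmBE subnn mnm0E.
Qed.

Lemma D_phi a P : D a (phi P) = \sum_b phi P^`M(b) * jac a b.
Proof.
rewrite -[LHS]/((D a \o phi) P) (@derivation_mpoly _ _ _ phi (D a \o phi)).
- by apply: eq_bigr => b _; rewrite mxE.
- by split=> x y /=; rewrite ?rmorphD ?rmorphM ?(D_der a).1 ?(D_der a).2.
- by move=> x; rewrite /= phiC D_const.
Qed.

(* A derivation killing phi(A) kills the algebraic extension i(A) as well. *)
Lemma jac_unit : jac \in unitmx.
Proof.
rewrite -row_free_unit -kermx_eq0; apply/rowV0P => v /sub_kermxP vJ.
pose delta z := \sum_a v 0 a * D a z.
have dd : derivation_along idfun delta.
  split=> x y; rewrite /delta.
    by rewrite -big_split; apply: eq_bigr => a _; rewrite (D_der a).1 mulrDr.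
  rewrite mulr_suml mulr_sumr -big_split; apply: eq_bigr => a _.
  by rewrite (D_der a).2 /=; ring.
have dC x : delta (i x%:MP) = 0.
  by rewrite /delta big1 // => a _; rewrite D_const mulr0.
have dphi : forall P, delta (phi P) = 0.
  apply: phi_derivation_eq0 => // b; move/matrixP: vJ => /(_ 0 b).
  by rewrite !mxE => <-; apply: eq_bigr => a _; rewrite mxE.
have [c [lam m0]] := exists_multiplier_neq0.
have dpencil o : delta (i (pencil c lam o)) = 0.
  have [Q /(_ delta dd)] := derivation_orbit_relation (pencil c lam o).
  rewrite big1 => [|m _]; last by rewrite dphi mul0r.
  rewrite oppr0 => /eqP; rewrite mulf_eq0 -(rmorph0 i) (inj_eq i_inj) rmorph0.
  have/prodf_neq0/(_ o isT)/negbTE -> := m0.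
  by move/eqP.
have dX b : delta (i 'X_b) = 0.
  have := dpencil (Some b); rewrite /= rmorphD dd.1 -mul_mpolyC rmorphM dd.2 dC.
  by rewrite mul0r add0r (dpencil None) mulr0 addr0.
apply/rowP => b; rewrite mxE -(dX b) /delta (bigD1 b) //= D_i_X eqxx mulr1.
by rewrite big1 ?addr0 // => a ab; rewrite D_i_X (negbTE ab) mulr0.
Qed.

(** Row [b] of the inverse Jacobian gives the derivation that acts on [phi(A)] as the partial
    derivative in variable [b], hence preserves [phi(A)]. The orbit relation then controls it on
    [i(A)], with the multipliers themselves as denominators. *)
Lemma inv_jac_integral b a : integralOver i (invmx jac b a).
Proof.
pose y P := \sum_a invmx jac b a * D a (i P).
have yX c : y 'X_c = invmx jac b c.
  rewrite /y (bigD1 c) //= D_i_X eqxx mulr1 big1 ?addr0 // => d dc.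
  by rewrite D_i_X (negbTE dc) mulr0.
have yorbit l : joint (i (orbit_diff act l) * y l).
  have [Q QE] := derivation_orbit_relation l.
  have -> : i (orbit_diff act l) * y l =
      - \sum_(m < size Q) phi (j Q`_m)^`M(b) * i l ^+ m.
    have ZJ b' : \sum_c invmx jac b c * jac c b' = (b == b')%:R.
      by have /matrixP/(_ b b') := mulVmx jac_unit; rewrite !mxE.
    rewrite mulr_sumr; under eq_bigr => c _ do rewrite mulrCA (QE _ (D_der c)) mulrN.
    rewrite sumrN; congr (- _); under eq_bigr => c _ do rewrite mulr_sumr.
    rewrite exchange_big; apply: eq_bigr => m _ /=.
    under eq_bigr => c _ do rewrite mulrA D_phi.
    rewrite -mulr_suml; congr (_ * _); under eq_bigr => c _ do rewrite mulr_sumr.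
    have row b' : \sum_c invmx jac b c * (phi (j Q`_m)^`M(b') * jac c b')
        = (b == b')%:R * phi (j Q`_m)^`M(b').
      by rewrite -ZJ mulr_suml; apply: eq_bigr => c _; ring.
    rewrite exchange_big; under eq_bigr => b' _ do rewrite row.
    rewrite (bigD1 b) //= eqxx mul1r big1 ?addr0 // => b' b'b.
    by rewrite eq_sym (negbTE b'b) mul0r.
  apply/joint_opp/joint_sum => m _.
  by apply: joint_mul; [apply: joint_phi | apply/joint_exp/joint_i].
pose F (d : A) := exists c lam, d = multiplier r c lam.
apply: (@integral_by_coprime_multipliers _ _ _ F _ factorial_A i_inj).
- have [c [lam m0]] := exists_multiplier_neq0.
  by exists (multiplier r c lam) => //; exists c, lam.
- move=> p pp; have [c [lam cP]] := multiplier_coprime k_char r1 rM r_codim pp.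
  by exists (multiplier r c lam) => //; exists c, lam.
- move=> _ [c [lam ->]]; exists 1%N; rewrite expr1 -yX; apply: joint_integral.
  apply: (@joint_from_pencil _ y c lam).
  + exact: joint_i.
  + move=> P Q; rewrite /y -big_split; apply: eq_bigr => d _.
    by rewrite rmorphD (D_der d).1 mulrDr.
  + move=> x P; rewrite /y mulr_sumr; apply: eq_bigr => d _.
    by rewrite -mul_mpolyC rmorphM (D_der d).2 D_const mul0r add0r mulrCA.
  + move=> o; rewrite /multiplier (bigD1 o) //= rmorphM mulrAC.
    by apply: joint_mul; [apply: yorbit | apply: joint_i].
Qed.


Lemma evaluation_extends : exists ev0 : E -> k,
  [/\ forall x y, integralOver i x -> integralOver i y -> ev0 (x + y) = ev0 x + ev0 y,
      forall x y, integralOver i x -> integralOver i y -> ev0 (x * y) = ev0 x * ev0 y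
    & forall P, ev0 (i P) = evp 0 P].
Proof.
apply: (@lying_over k A E i (@mpolyC n k) (evp 0) _ i_inj (integralOver i)) => //.
- by move=> x /=; rewrite evpC.
- exact: integral_id.
- exact: integral_add.
- exact: integral_mul.
Qed.

(** * Taylor expansion at the origin and the formal lift *)

Section Taylor.

Variable ev0 : E -> k.
Hypothesis ev0D : forall x y,
  integralOver i x -> integralOver i y -> ev0 (x + y) = ev0 x + ev0 y.
Hypothesis ev0M : forall x y,
  integralOver i x -> integralOver i y -> ev0 (x * y) = ev0 x * ev0 y.
Hypothesis ev0_i : forall P, ev0 (i P) = evp 0 P.

Lemma ev0C x : ev0 (i x%:MP) = x.
Proof. by rewrite ev0_i evpC. Qed.

Lemma ev0_sum (I : Type) (q : seq I) (P : pred I) (F : I -> E) :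
  (forall l, integralOver i (F l)) ->
  ev0 (\sum_(l <- q | P l) F l) = \sum_(l <- q | P l) ev0 (F l).
Proof.
move=> Fi; elim: q => [|l q IH]; first by rewrite !big_nil -(rmorph0 i) ev0_i rmorph0.
rewrite !big_cons; case: (P l) => //; rewrite ev0D ?IH //.
by elim/big_ind: _ => //; [exact: integral0 | exact: integral_add].
Qed.

(* The matrix of the linear part of the formal lift, acting on columns. *)
Definition lin : 'M[k]_n := \matrix_(b, a) ev0 (jac a b).

Lemma jac_tame a b : tame (jac a b).
Proof. by rewrite mxE; apply/tame_D/joint_tame/joint_phi. Qed.

(** Evaluate [invmx jac *m jac = 1] at the origin. Integrality of both factors is what allows [ev0]
    to be applied to the products. *)
Lemma lin_unit : lin \in unitmx.
Proof.
pose N : 'M[k]_n := \matrix_(a, b) ev0 (invmx jac b a).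
suff /mulmx1_unit[] : lin *m N = 1%:M by [].
apply/matrixP => b b'; rewrite !mxE.
have /matrixP/(_ b' b) := mulVmx jac_unit.
rewrite !mxE => /(congr1 ev0); rewrite ev0_sum => [|a]; last first.
  by apply: integral_mul; [apply: inv_jac_integral | apply/tame_integral/jac_tame].
rewrite (_ : (b' == b)%:R = i (((b == b')%:R)%:MP)) ?ev0C => [<-|]; last first.
  by rewrite eq_sym mpolyC_nat rmorph_nat.
have NE a : N a b' = ev0 (invmx jac b' a) by rewrite mxE.
have linE a : lin b a = ev0 (jac a b) by rewrite mxE.
apply: eq_bigr => a _; rewrite NE linE ev0M; first by rewrite mulrC.
  exact: inv_jac_integral.
exact/tame_integral/jac_tame.
Qed.

Definition direction (u : V) (z : E) : E := \sum_a i (u a 0)%:MP * D a z.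

Lemma direction_derivation u : derivation_along idfun (direction u).
Proof.
split=> x y; rewrite /direction.
  by rewrite -big_split; apply: eq_bigr => a _; rewrite (D_der a).1 mulrDr.
rewrite mulr_suml mulr_sumr -big_split; apply: eq_bigr => a _.
by rewrite (D_der a).2 /=; ring.
Qed.

Lemma direction_const u x : direction u (i x%:MP) = 0.
Proof. by rewrite /direction big1 // => a _; rewrite D_const mulr0. Qed.

Lemma tame_sum (I : Type) (q : seq I) (P : pred I) (F : I -> E) :
  (forall l, tame (F l)) -> tame (\sum_(l <- q | P l) F l).
Proof.
by move=> tF; elim/big_ind: _ => //; [exact/joint_tame/joint0 | exact: tame_add].
Qed.

Lemma tame_direction u z : tame z -> tame (direction u z).
Proof.
move=> tz; apply: tame_sum => a; apply: tame_mul; last exact: tame_D.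
exact/joint_tame/joint_i.
Qed.

(** The expansion of [z] along the line [t u] at [t = 0]. Series in one variable suffice because [u]
    is arbitrary. *)
Definition taylor (u : V) (z : E) : pseries k :=
  fun m => ev0 (iter m (direction u) z) / (m`!)%:R.

Lemma nat_neq0 m : (m.+1)%:R != 0 :> k.
Proof. by rewrite ((pcharf0P k).1 k_char). Qed.

Lemma taylorS u z m : taylor u z m.+1 * (m.+1)%:R = taylor u (direction u z) m.
Proof.
rewrite /taylor iterSr factS natrM invfM -!mulrA [_^-1 * (_ * _)]mulrCA.
by rewrite mulVf ?mulr1 ?nat_neq0.
Qed.

Lemma taylor0 u z : taylor u z 0 = ev0 z.
Proof. by rewrite /taylor /= fact0 divr1. Qed.

Lemma taylorD u x y : tame x -> tame y -> taylor u (x + y) = taylor u x + taylor u y.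
Proof.
move=> tx ty; apply/funext => m; rewrite pseriesDE.
elim: m x y tx ty => [|m IH] x y tx ty.
  by rewrite !taylor0 ev0D //; apply: tame_integral.
apply: (mulIf (nat_neq0 m)); rewrite mulrDl !taylorS (direction_derivation u).1.
by apply: IH; apply: tame_direction.
Qed.

Lemma taylorM u x y : tame x -> tame y -> taylor u (x * y) = taylor u x * taylor u y.
Proof.
move=> tx ty; apply/funext => m.
elim: m x y tx ty => [|m IH] x y tx ty.
  by rewrite pseriesME big_ord1 !taylor0 ev0M //; apply: tame_integral.
apply: (mulIf (nat_neq0 m)); rewrite taylorS (direction_derivation u).2 /=.
rewrite taylorD; try by apply: tame_mul => //; apply: tame_direction.
rewrite pseriesDE !IH //; try exact: tame_direction.
rewrite !pseriesME mulr_suml.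
(* The factor [m.+1] is split as [l + (m.+1 - l)], matching the two terms of the Leibniz rule. *)
transitivity (\sum_(l < m.+2) (taylor u x l * taylor u y (m.+1 - l)%N * l%:R
   + taylor u x l * taylor u y (m.+1 - l)%N * (m.+1 - l)%:R)); last first.
  apply: eq_bigr => l _; rewrite -mulrDr -natrD subnKC //.
  by rewrite -ltnS.
rewrite big_split; congr (_ + _).
  rewrite [RHS]big_ord_recl /= mulr0 add0r; apply: eq_bigr => l _.
  by rewrite /= /bump /= add1n subSS -taylorS; ring.
rewrite [RHS]big_ord_recr /= subnn mulr0 addr0; apply: eq_bigr => l _.
have lm : (l <= m)%N by rewrite -ltnS.
by rewrite subSn // -mulrA taylorS.
Qed.

Lemma taylorC u x : taylor u (i x%:MP) = fun m => if m is 0 then x else 0.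
Proof.
apply/funext => -[|m]; first by rewrite taylor0 ev0C.
apply: (mulIf (nat_neq0 m)); rewrite taylorS mul0r direction_const /taylor.
suff -> : iter m (direction u) 0 = i 0%:MP by rewrite ev0C mul0r.
rewrite mpolyC0 rmorph0; elim: m => //= m ->.
exact: derivation0 (direction_derivation u).
Qed.

Lemma taylor_zmod_morphism (f : {rmorphism A -> E}) u : (forall P, tame (f P)) ->
  zmod_morphism (fun P => taylor u (f P)).
Proof.
move=> tf P Q; apply: (addIr (taylor u (f Q))).
by rewrite -taylorD // -rmorphD !subrK.
Qed.

Lemma taylor_monoid_morphism (f : {rmorphism A -> E}) u : (forall P, tame (f P)) ->
  monoid_morphism (fun P => taylor u (f P)).
Proof.
move=> tf; split=> [|P Q]; last by rewrite rmorphM taylorM.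
by rewrite rmorph1 -(rmorph1 i) -mpolyC1 taylorC; apply/funext => -[].
Qed.

Definition taylor_rmorphism (f : {rmorphism A -> E}) (tf : forall P, tame (f P)) u :
    {rmorphism A -> pseries k} :=
  HB.pack (fun P => taylor u (f P))
    (GRing.isZmodMorphism.Build A (pseries k) (fun P => taylor u (f P))
       (taylor_zmod_morphism u tf))
    (GRing.isMonoidMorphism.Build A (pseries k) (fun P => taylor u (f P))
       (taylor_monoid_morphism u tf)).

Lemma tame_i P : tame (i P). Proof. exact/joint_tame/joint_i. Qed.
Lemma tame_phi P : tame (phi P). Proof. exact/joint_tame/joint_phi. Qed.

(** The series of P(F(t u)), where F is the formal lift; the map called F_u below. *)
Definition lift u : {rmorphism A -> pseries k} := taylor_rmorphism tame_phi u.

Arguments lift : simpl never.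

Lemma liftE u P : lift u P = taylor u (phi P). Proof. by []. Qed.

Lemma lift_j u b : lift u (j b) = taylor u (i (j (s b))).
Proof. by rewrite liftE phi_j. Qed.

Definition line_subst (u : V) : {rmorphism A -> {poly k}} :=
  mmap polyC (fun a => (u a 0)%:P * 'X).

Lemma line_substC u x : line_subst u x%:MP = x%:P.
Proof. by rewrite /= mmapC. Qed.

Lemma line_substX u a : line_subst u 'X_a = (u a 0)%:P * 'X.
Proof. by rewrite /= mmapX mmap1U. Qed.

Lemma line_subst_mul M u P : line_subst (M *m u) P = line_subst u (mpoly_subst M P).
Proof.
apply: (@mpoly_rmorph_ext n k _ (line_subst (M *m u)) (line_subst u \o mpoly_subst M)).
  by move=> x; rewrite line_substC [RHS]/= mmapC -[RHS]/(line_subst u _) line_substC.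
move=> a; rewrite line_substX [RHS]/= mmapX mmap1U -[RHS]/(line_subst u _).
rewrite rmorph_sum mxE raddf_sum mulr_suml; apply: eq_bigr => b _.
by rewrite -mul_mpolyC rmorphM line_substC line_substX mxE mulrA -polyCM.
Qed.

Lemma line_subst_horner u P : (line_subst u P).[1] = evp u P.
Proof.
apply: (@mpoly_rmorph_ext n k _ (horner_eval 1 \o line_subst u) (evp u)) => [x|a].
  by rewrite -[LHS]/(line_subst u _).[1] line_substC hornerC [RHS]evpC.
by rewrite -[LHS]/(line_subst u _).[1] line_substX !hornerE [RHS]evpX.
Qed.

Lemma taylor_i u P : taylor u (i P) = ps_of_poly (line_subst u P).
Proof.
apply: (@mpoly_rmorph_ext n k _ (taylor_rmorphism tame_i u)
  (@ps_of_poly k \o line_subst u)) => [x|a].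
  rewrite -[LHS]/(taylor u (i x%:MP)) -[RHS]/(ps_of_poly (line_subst u _)).
  by rewrite line_substC taylorC; apply/funext => -[|m]; rewrite /ps_of_poly coefC.
rewrite -[LHS]/(taylor u (i 'X_a)) -[RHS]/(ps_of_poly (line_subst u _)).
rewrite line_substX; apply/funext => m; rewrite /ps_of_poly coefCM coefX.
case: m => [|m]; first by rewrite taylor0 ev0_i evpX mxE mulr0.
apply: (mulIf (nat_neq0 m)); rewrite taylorS.
have -> : direction u (i 'X_a) = i (u a 0)%:MP.
  rewrite /direction (bigD1 a) //= D_i_X eqxx mulr1 big1 ?addr0 // => b ba.
  by rewrite D_i_X (negbTE ba) mulr0.
by rewrite taylorC; case: m => [|m]; rewrite ?mulr1 // mulr0 mul0r.
Qed.

Lemma lift_invariant g u b : lift (r g *m u) (j b) = lift u (j b).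
Proof.
rewrite !lift_j !taylor_i line_subst_mul; congr (ps_of_poly (line_subst _ _)).
exact: pact_j.
Qed.

(** The passage from formal statements to points: on invariants the series is a polynomial in [t],
    and [t = 1] gives the value at [u]. *)
Lemma lift_eq0 u b : lift u (j b) = 0 -> evp u (j (s b)) = 0.
Proof.
rewrite lift_j taylor_i => H; rewrite -line_subst_horner.
suff -> : line_subst u (j (s b)) = 0 by rewrite horner0.
by apply/polyP => m; move/(congr1 (fun f => f m)): H; rewrite coef0.
Qed.

Lemma liftC u x : lift u x%:MP = fun m => if m is 0 then x else 0.
Proof. by rewrite liftE phiC taylorC. Qed.

Lemma liftZ u x P : lift u (x *: P) = lift u x%:MP * lift u P.
Proof. by rewrite -mul_mpolyC rmorphM. Qed.

Lemma lift_linear_form u (a b : k) (c d : 'rV[k]_n) :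
  lift u (linear_form (a *: c + b *: d)) =
  lift u a%:MP * lift u (linear_form c) + lift u b%:MP * lift u (linear_form d).
Proof.
rewrite -!liftZ -rmorphD; congr (lift u _).
rewrite /linear_form !scaler_sumr -big_split; apply: eq_bigr => l _.
by rewrite !mxE scalerDl !scalerA.
Qed.

Lemma linear_form_delta b : linear_form (delta_mx 0 b) = 'X_b :> A.
Proof.
rewrite /linear_form (bigD1 b) //= mxE !eqxx scale1r big1 ?addr0 // => a ab.
by rewrite mxE (negbTE ab) scale0r.
Qed.

(** The lifts along [u] and [r g *m u] agree on invariants, so the orbit polynomial of [P], pushed
    forward by [lift u], kills [lift (r g *m u) P]. Power series form a domain, so one linear factor
    vanishes. *)
Lemma lift_orbit g u P : exists h, lift (r g *m u) P = lift u (act h P).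
Proof.
have [Q QE] := orbit_poly_lift P; apply: contrapT => nex.
have : (map_poly (lift u) (orbit_poly act P)).[lift (r g *m u) P] = 0.
  rewrite -QE -map_poly_comp (eq_map_poly (g := lift (r g *m u) \o j)) => [|b]; last first.
    exact/esym/lift_invariant.
  by rewrite map_poly_comp horner_map QE (eqP (root_orbit_poly act1 P)) rmorph0.
rewrite rmorph_prod horner_prod; elim/big_rec: _ => [/eqP|h x _ IH].
  by rewrite oner_eq0.
case/pseries_mul_eq0 => //.
have -> : (map_poly (lift u) ('X - (act h P)%:P)).[lift (r g *m u) P] =
    lift (r g *m u) P - lift u (act h P).
  by rewrite map_polyXsubC hornerXsubC.
by move/eqP; rewrite subr_eq0 => /eqP E'; apply: nex; exists h.
Qed.

(** In [lift_orbit], [h] depends on [P]. The linear forms for which a given [h] works form a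
    subspace, and finitely many proper subspaces cannot cover. *)
Lemma lift_uniform g u : exists h, forall P, lift (r g *m u) P = lift u (act h P).
Proof.
have [h hP] : exists h, forall c : 'rV[k]_n,
    lift (r g *m u) (linear_form c) = lift u (act h (linear_form c)).
  apply: contrapT => nex.
  have [h|h|c cP] := @thin_avoid k 'rV[k]_n k_char _
      (fun h c => lift (r g *m u) (linear_form c) = lift u (act h (linear_form c))).
  - apply: thin_subspace => a b c d; rewrite !pact_linear_form // => hc hd.
    by rewrite mulmxDl -!scalemxAl !lift_linear_form !liftC hc hd.
  - apply: contrapT => nc; apply: nex; exists h => c; apply: contrapT => hc.
    by apply: nc; exists c.
  - by have [h /cP] := lift_orbit g u (linear_form c).
exists h; apply: (@mpoly_rmorph_ext n k _ (lift (r g *m u)) (lift u \o act h)) => [x|b].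
  by rewrite -j_cB -[RHS]/(lift u (act h (j (cB x)))) pact_j lift_invariant.
by rewrite -linear_form_delta; apply: hP.
Qed.

Lemma lift_order1 u c : lift u (linear_form c) 1%N = (c *m (lin *m u)) 0 0.
Proof.
have liftX b : lift u 'X_b 1%N = (lin *m u) b 0.
  rewrite -[LHS]mulr1 liftE (taylorS u (phi 'X_b) 0) taylor0 /direction.
  have Di a : D a (phi 'X_b) = jac a b by rewrite mxE.
  rewrite ev0_sum => [|a]; last first.
    apply: integral_mul; first exact: integral_id.
    by rewrite Di; apply/tame_integral/jac_tame.
  rewrite mxE; apply: eq_bigr => a _.
  rewrite Di ev0M; last exact/tame_integral/jac_tame; last exact: integral_id.
  by rewrite ev0C [lin b a]mxE mulrC.
rewrite rmorph_sum mxE; elim/big_ind2: _ => // [x x' y y' <- <-//|b _].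
rewrite -liftX liftZ pseriesME big_ord_recl big_ord1 liftC subn0.
exact: etrans (congr1 (+%R _) (mul0r _)) (addr0 _).
Qed.

Lemma lift_first_order g u h : (forall P, lift (r g *m u) P = lift u (act h P)) ->
  lin *m r g *m u = r h *m lin *m u.
Proof.
move=> gh; apply/matrixP => b z; rewrite ord1.
have row (w : V) : w b 0 = ((delta_mx 0 b : 'rV[k]_n) *m w) 0 0 by rewrite -rowE mxE.
rewrite row -mulmxA -lift_order1 gh pact_linear_form // lift_order1.
by rewrite [RHS]row !mulmxA.
Qed.

(** Comparing first-order terms gives an [h] depending on [u]; the same covering argument, now for
    subspaces of V, makes it uniform. *)
Lemma conj_exists g : exists h, lin *m r g = r h *m lin.
Proof.
apply: contrapT => nex.
have [h|h|u uP] := @thin_avoid k V k_char _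
    (fun h u => lin *m r g *m u = r h *m lin *m u).
- by apply: thin_subspace => a b x y hx hy; rewrite !mulmxDr -!scalemxAr hx hy.
- apply: contrapT => nu; apply: nex; exists h; apply/matrixP => a b.
  have : lin *m r g *m (delta_mx b 0 : V) = r h *m lin *m delta_mx b 0.
    by apply: contrapT => gh; apply: nu; exists (delta_mx b 0).
  by rewrite -!colE => /matrixP/(_ a 0); rewrite !mxE.
- by have [h /lift_first_order/uP] := lift_uniform g u.
Qed.

Lemma taylorCM u x z m : tame z -> taylor u (i x%:MP * z) m = x * taylor u z m.
Proof.
move=> tz; rewrite taylorM //; last exact: tame_i.
rewrite pseriesME big_ord_recl taylorC subn0 big1 ?addr0 // => l _.
exact: mul0r.
Qed.

(** By induction on [m], since [direction u] depends linearly on [u]. *)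
Lemma line_poly_taylor z m : tame z -> line_poly (fun u => taylor u z m).
Proof.
elim: m z => [|m IH] z tz.
  apply: (@line_poly_eq k V (fun=> ev0 z)); last exact: line_polyC.
  by move=> u; rewrite taylor0.
have sumE u : taylor u (direction u z) m = \sum_a u a 0 * taylor u (D a z) m.
  rewrite /direction; elim: (index_enum _) => [|a q IHq].
    by rewrite !big_nil -(rmorph0 i) -mpolyC0 taylorC; case: (m).
  rewrite !big_cons taylorD ?pseriesDE ?IHq ?taylorCM //; try exact: tame_D.
    by apply: tame_mul; [apply: tame_i | apply: tame_D].
  apply: tame_sum => b; apply: tame_mul; [exact: tame_i | exact: tame_D].
have -> : (fun u => taylor u z m.+1) =
    (fun u => (m.+1)%:R^-1 * \sum_a u a 0 * taylor u (D a z) m).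
  apply/funext => u; rewrite -sumE -taylorS mulrCA mulVf ?mulr1 //.
  exact: nat_neq0.
apply: line_polyM; first exact: line_polyC.
apply: line_poly_sum => a; apply: line_polyM; last exact/IH/tame_D.
by apply: line_poly_linear => c x y; rewrite !mxE.
Qed.

Lemma r_inj : injective r.
Proof.
move=> g h gh; apply/eqP; rewrite -[g == h](inj_eq (mulIg h^-1%g)) mulgV.
apply: contraT => /(codim_neq0 r_codim).
by rewrite rM gh -rM mulgV r1 subrr eqxx.
Qed.

(** First-order terms only determine [tau g]; here the full series is compared. A failure at [u0] in
    degree [m] persists at some [u] with [lin *m u] free, coefficients being polynomial along lines,
    but there the first order forces the [h] of [lift_uniform] to be [tau g]. *)
Lemma conj_lift (tau : gT -> gT) : (forall g, lin *m r g = r (tau g) *m lin) ->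
  forall g u P, lift (r g *m u) P = lift u (act (tau g) P).
Proof.
move=> tauE g u0 P; apply/funext => m; apply: contrapT => ne.
pose f u := lift (r g *m u) P m - lift u (act (tau g) P) m.
pose Z (o : option gT) (u : V) := if o is Some h
  then h != 1%g /\ r h *m (lin *m u) = lin *m u else f u = 0.
have [[h|]|[h|]|u uP] := @thin_avoid k V k_char _ Z.
- apply: thin_subspace => a b x y [h1 hx] [_ hy]; split=> //.
  by rewrite !mulmxDr -!scalemxAr hx hy.
- apply: thin_line_poly => p q.
  have [F FE] := line_poly_taylor m (tame_phi P) (r g *m p) (r g *m q).
  have [G GE] := line_poly_taylor m (tame_phi (act (tau g) P)) p q.
  exists (F - G) => t; rewrite hornerD hornerN -FE -GE /f.
  by rewrite mulmxDr -scalemxAr mulmxBr.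
- have [->|h1] := eqVneq h 1%g; first by exists 0 => -[]; rewrite eqxx.
  have := codim_neq0 r_codim h1.
  apply: contraNP => nex; apply/eqP/matrixP => a b.
  have : r h *m delta_mx b 0 = delta_mx b 0 :> V.
    apply: contrapT => hb; apply: nex; exists (invmx lin *m delta_mx b 0) => -[_].
    by rewrite mulKVmx ?lin_unit.
  move/eqP; rewrite -subr_eq0 -{2}[delta_mx b 0]mul1mx -mulmxBl -colE => /eqP/matrixP.
  by move/(_ a 0); rewrite !mxE.
- by exists u0 => /eqP; rewrite subr_eq0 => /eqP.
have [h hP] := lift_uniform g u.
have := lift_first_order hP; rewrite tauE -!mulmxA => hu.
case: (eqVneq h (tau g)) => [hE|hg].
  by apply: (uP None); rewrite /= /f hP hE subrr.
apply: (uP (Some ((tau g)^-1 * h)%g)); split.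
  by apply: contraNneq hg => /(congr1 (mulg (tau g))); rewrite mulKVg mulg1 => ->.
by rewrite rM -mulmxA -hu mulmxA -rM mulVg r1 mul1mx.
Qed.

(* If no conjugate of w is fixed by tau(H), where H is the stabiliser of u, some
   linear form l vanishes on the fixed space of tau(H) but nowhere on the orbit
   of w.  The lift kills l because F_u = F_u o tau(g) for g in H, hence kills the
   norm of l, which must then vanish at w. *)
Lemma conj_fixed (tau : gT -> gT) : (forall g, lin *m r g = r (tau g) *m lin) ->
  (forall g h, tau (g * h)%g = (tau g * tau h)%g) ->
  forall u w, (forall b, evp w (j b) = evp u (j (s b))) ->
  exists x, forall g, r g *m u = u -> r (tau g) *m (r x *m w) = r x *m w.
Proof.
move=> tauE tauM u w uw.
pose H := [set g | r g *m u == u].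
have Hgroup : group_set H.
  apply/group_setP; split=> [|g h]; first by rewrite inE r1 mul1mx.
  by rewrite !inE rM -mulmxA => /eqP gu /eqP ->; rewrite gu.
(* The averaging projector onto the fixed space of tau(H); forms of shape [c *m (1 - e)] vanish on
   that space. *)
pose e : 'M[k]_n := (#|H|%:R)^-1 *: \sum_(g in H) r (tau g).
have H0 : (#|H|%:R : k) != 0.
  have := cards_eq0 H; case: #|H| => [|m]; last by rewrite nat_neq0.
  by move/esym/eqP => HE; case/group_setP: Hgroup; rewrite HE inE.
have re g : g \in H -> r (tau g) *m e = e.
  move=> gH; rewrite -scalemxAr mulmx_sumr; congr (_ *: _).
  rewrite [RHS](reindex_inj (mulgI g)) /=; apply: eq_big => [h|h _].
    by rewrite -[H]/(gval (Group Hgroup)) groupMl.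
  by rewrite tauM rM.
have [[x xP]|nex] := pselect (exists x, e *m (r x *m w) = r x *m w).
  by exists x => g gu; rewrite -xP mulmxA re // inE gu.
have [x|x|c cP] := @thin_avoid k 'rV[k]_n k_char _
    (fun x c => (c *m (r x *m w - e *m (r x *m w))) 0 0 = 0).
- apply: thin_subspace => a b c d cx dx.
  rewrite mulmxDl -(scalemxAl a c) -(scalemxAl b d).
  rewrite mxE [X in X + _]mxE [X in _ + X]mxE cx dx.
  by rewrite !mulr0 addr0.
- have : r x *m w - e *m (r x *m w) != 0.
    by rewrite subr_eq0; apply/eqP => xE; apply: nex; exists x.
  move/cV0Pn => [a ra]; exists (delta_mx 0 a); rewrite -rowE mxE.
  exact/eqP.
pose l : A := linear_form (c *m (1%:M - e)).
have [b bE] := norm_invariant k_char rM j_surj l.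
have : evp w (j b) != 0.
  rewrite bE rmorph_prod; apply/prodf_neq0 => x _.
  rewrite /= evp_pact // evp_linear_form; apply/eqP => x0; apply: (cP x).
  by rewrite -x0 -mulmxA mulmxBl mul1mx.
case/eqP; rewrite uw; apply: lift_eq0.
rewrite bE /orbit_norm (bigD1 1%g) // rmorphM [X in lift u X * _]act1.
suff -> : lift u l = 0 by rewrite mul0r.
have liftH g : g \in H -> lift u (linear_form (c *m r (tau g))) = lift u (linear_form c).
  by rewrite inE => /eqP gu; rewrite -pact_linear_form // -(conj_lift tauE) gu.
have lE : l = linear_form c - (#|H|%:R)^-1 *: \sum_(g in H) linear_form (c *m r (tau g)).
  apply: evp_ext => // y; rewrite /l evp_linear_form rmorphB /= evpZ evp_linear_form.
  have -> : evp y (\sum_(g in H) linear_form (c *m r (tau g))) =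
      \sum_(g in H) (c *m r (tau g) *m y) 0 0.
    by rewrite rmorph_sum; apply: eq_bigr => g _; apply: evp_linear_form.
  rewrite mulmxBr mulmx1 mulmxBl [LHS]mxE [X in _ + X]mxE; congr (_ - _).
  by rewrite /e -scalemxAr mulmx_sumr -scalemxAl mulmx_suml mxE summxE.
have sumE : lift u (\sum_(g in H) linear_form (c *m r (tau g))) =
    lift u (#|H|%:R)%:MP * lift u (linear_form c).
  rewrite rmorph_sum (eq_bigr (fun=> lift u (linear_form c))) //.
  by rewrite sumr_const mpolyC_nat rmorph_nat mulr_natl.
rewrite lE rmorphB liftZ sumE mulrA -[in X in _ - X]rmorphM -mpolyCM mulVf //.
by rewrite mpolyC1 rmorph1 mul1r subrr.
Qed.

End Taylor.

End Compositum.

(** * Stabilisers under an automorphism of the quotient *)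

Section InvariantAutomorphism.

Variables (k : closedFieldType) (n : nat).
Hypothesis k_char : [pchar k] =i pred0.
Local Notation A := {mpoly k[n]}.
Local Notation V := 'cV[k]_n.
Variables (gT : finGroupType) (r : gT -> 'M[k]_n).
Hypothesis r1 : r 1%g = 1%:M.
Hypothesis rM : forall g h, r (g * h)%g = r g *m r h.
Hypothesis r_codim : forall g, g != 1%g -> forall w : V,
  exists x, forall t, (r g - 1%:M) *m x != t *: w.
Variables (B : comNzRingType) (j : {rmorphism B -> A}) (cB : k -> B).
Hypothesis j_inj : injective j.
Hypothesis pact_j : forall g b, pact r g (j b) = j b.
Hypothesis j_surj : forall P, (forall g, pact r g P = P) -> exists b, j b = P.
Hypothesis j_cB : forall x, j (cB x) = x%:MP.
Variables (s s' : {rmorphism B -> B}).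
Hypothesis sK : cancel s s'.
Hypothesis s'K : cancel s' s.
Hypothesis s_cB : forall x, s (cB x) = cB x.

Let act1 := pact1 k_char r1.
Let actM := pactM k_char rM.

Lemma separating_form : exists l : A, forall g, g != 1%g -> pact r g l != l.
Proof.
have [x xfree] := exists_free_point k_char r_codim.
have [c [lam sep]] := pencil_separates k_char r1 rM xfree.
exists (linear_form c) => g g1; have := sep None g 1%g g1.
rewrite r1 mul1mx -[pencil _ _ _]/(linear_form c) -evp_pact //.
by apply: contra_neq => lE; rewrite lE.
Qed.

(** Adjoin to the fractions of A a root [y] of the orbit polynomial of a separating [l], with
    coefficients moved by [s]. Then [etale_lift] yields the [phi] with [phi l = y]. *)
Lemma compositum_exists : exists (E : fieldType) (i phi : {rmorphism A -> E})
    (D : 'I_n -> E -> E),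
  [/\ injective i, forall b, phi (j b) = i (j (s b)),
      forall a, derivation_along idfun (D a) & forall a P, D a (i P) = i P^`M(a)].
Proof.
have [l lsep] := separating_form.
have [Q QE] := @orbit_poly_lift k n k_char gT r rM B j j_surj l.
have s_inj := can_inj sK.
have Pmon : map_poly (j \o s) Q \is monic.
  apply: monic_map; rewrite monicE -(inj_eq j_inj) -lead_coef_map_inj ?rmorph0 // QE rmorph1.
  exact/eqP/monicP/orbit_poly_monic.
have P1 : (1 < size (map_poly (j \o s) Q))%N.
  have js_inj : injective (j \o s) by apply: inj_comp.
  rewrite size_map_inj_poly ?rmorph0 // -(size_map_inj_poly j_inj (rmorph0 j)) QE.
  by rewrite size_prod_XsubC /index_enum -enumT -cardE ltnS; apply/card_gt0P; exists 1%g.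
have [E [i [y [i_inj yroot ygen]]]] := root_field Pmon P1.
pose psi : {rmorphism B -> E} := i \o (j \o s).
have psi_inj : injective psi by apply: inj_comp => //; apply: inj_comp.
have [|phi [phi_j _]] := @etale_lift gT A (pact r) act1 actM B j j_inj pact_j j_surj
    E psi l y psi_inj lsep.
  move=> Q'; rewrite -QE => /(map_inj_poly j_inj (rmorph0 j)) ->.
  by rewrite map_poly_comp.
have Achar : [pchar A] =i pred0.
  apply/pcharf0P => m; rewrite -mpolyC_nat mpolyC_eq0.
  exact: (pcharf0P k).1.
have dd a : derivation_along i (fun P => i P^`M(a)).
  split=> P R; first by rewrite mderivD rmorphD.
  by rewrite mderivM rmorphD !rmorphM.
have [D DP] := choice (fun a => derivation_extends (dd a) Achar i_inj ygen
  (monic_neq0 Pmon) yroot).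
exists E, i, phi, D; split=> // a; first by case: (DP a).
by have [_] := DP a; apply.
Qed.

Theorem automorphism_permutes_stabilisers : exists tau : gT -> gT,
  [/\ forall g h, tau (g * h)%g = (tau g * tau h)%g, injective tau
    & forall u w, (forall b, evp w (j b) = evp u (j (s b))) ->
      exists x, forall g, r g *m u = u -> r (tau g) *m (r x *m w) = r x *m w].
Proof.
have [E [i [phi [D [i_inj phi_j D_der D_i]]]]] := compositum_exists.
have [ev0 [ev0D ev0M ev0_i]] := evaluation_extends i_inj.
have Lu := lin_unit k_char r1 rM r_codim j_inj pact_j j_surj j_cB sK s'K s_cB i_inj
  phi_j D_der D_i ev0D ev0M ev0_i.
have [tau tauE] := choice (conj_exists k_char r1 rM r_codim j_inj pact_j j_surj j_cB
  sK s'K s_cB i_inj phi_j D_der D_i ev0D ev0M ev0_i).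
have r_inj := r_inj r1 rM r_codim.
have tauM g h : tau (g * h)%g = (tau g * tau h)%g.
  apply/r_inj/(can_inj (mulmxK Lu)).
  by rewrite -tauE !rM mulmxA tauE -!mulmxA tauE.
exists tau; split=> //.
  move=> g h gh; apply/r_inj/(can_inj (mulKmx Lu)).
  by rewrite !tauE gh.
exact: (conj_fixed k_char r1 rM r_codim j_inj pact_j j_surj j_cB sK s'K s_cB i_inj
  phi_j D_der D_i ev0D ev0M ev0_i tauE tauM).
Qed.


End InvariantAutomorphism.

(** * Luna strata *)

Section Quotient.

Variables (k : closedFieldType) (V : vectType k) (gT : finGroupType).
Variable rho : gT -> 'End(V).
Hypothesis k_char : [pchar k] =i pred0.
Hypothesis rho_faithful : faithful_repr rho.
Hypothesis rho_refl : forall g : gT, ~ pseudo_reflection (rho g).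

Local Notation n := (\dim {:V}).
Local Notation A := {mpoly k[n]}.
Local Notation B := (invariant_ring rho).

Definition coord_col (v : V) : 'cV[k]_n := \col_a coords v a.
Definition of_coord_col (x : 'cV[k]_n) : V := \sum_a x a 0 *: (vbasis {:V})`_a.
Definition rho_mx (g : gT) : 'M[k]_n :=
  \matrix_(a, b) coord (vbasis {:V}) a (rho g (vbasis {:V})`_b).

Lemma coord_colK : cancel coord_col of_coord_col.
Proof.
move=> v; rewrite [RHS](coord_vbasis (memvf v)).
by apply: eq_bigr => a _; rewrite mxE.
Qed.

Lemma of_coord_colK : cancel of_coord_col coord_col.
Proof.
move=> x; apply/colP => a; rewrite mxE /coords /of_coord_col.
rewrite linear_sum (bigD1 a) //= linearZ /= coord_free ?(basis_free (vbasisP _)) //.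
rewrite eqxx mulr1 big1 ?addr0 // => b ba.
rewrite linearZ /= coord_free ?(basis_free (vbasisP _)) //.
by move: ba; rewrite -val_eqE /= => /negbTE->; rewrite mulr0.
Qed.

Lemma coord_col_rho g v : coord_col (rho g v) = rho_mx g *m coord_col v.
Proof.
apply/colP => a; rewrite !mxE /coords {1}(coord_vbasis (memvf v)) !linear_sum.
by apply: eq_bigr => b _; rewrite !linearZ /= !mxE mulrC.
Qed.

Lemma coord_col_inj : injective coord_col. Proof. exact: can_inj coord_colK. Qed.

Lemma mx_by_columns (M N : 'M[k]_n) :
  (forall v, M *m coord_col v = N *m coord_col v) -> M = N.
Proof.
move=> MN; apply/matrixP => a b.
have := MN (of_coord_col (delta_mx b 0)); rewrite of_coord_colK -!colE.
by move/matrixP/(_ a 0); rewrite !mxE.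
Qed.

Lemma rho_mx1 : rho_mx 1%g = 1%:M.
Proof.
case: rho_faithful => rho1 _ _; apply: mx_by_columns => v.
by rewrite -coord_col_rho rho1 id_lfunE mul1mx.
Qed.

Lemma rho_mxM g h : rho_mx (g * h)%g = rho_mx g *m rho_mx h.
Proof.
case: rho_faithful => _ rhoM _; apply: mx_by_columns => v.
by rewrite -mulmxA -!coord_col_rho rhoM comp_lfunE.
Qed.

Lemma coord_colZ t v : coord_col (t *: v) = t *: coord_col v.
Proof. by apply/colP => a; rewrite !mxE /coords linearZ. Qed.

Lemma coord_colB u v : coord_col (u - v) = coord_col u - coord_col v.
Proof. by apply/colP => a; rewrite !mxE /coords linearB. Qed.

(** If [rho g - 1] had image in a line, rank-nullity would make the fixed space a hyperplane, the
    whole space being excluded by faithfulness. *)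
Lemma rho_mx_codim g : g != 1%g -> forall w : 'cV[k]_n,
  exists x, forall t, (rho_mx g - 1%:M) *m x != t *: w.
Proof.
have [rho1 rhoM rho_inj] := rho_faithful.
move=> g1 w; apply: contrapT => nex; apply: (rho_refl (g := g)).
have rhoK v : rho g^-1%g (rho g v) = v.
  by rewrite -comp_lfunE -rhoM mulVg rho1 id_lfunE.
have rhoXg m v : iter m (rho g) v = rho (g ^+ m)%g v.
  by elim: m => [|m IH]; rewrite ?expg0 ?rho1 ?id_lfunE // expgS rhoM comp_lfunE -IH.
have line v : rho g v - v \in <[of_coord_col w]>%VS.
  have [t tE] : exists t, (rho_mx g - 1%:M) *m coord_col v = t *: w.
    apply: contrapT => nt; apply: nex; exists (coord_col v) => t.
    by apply/eqP => tE; apply: nt; exists t.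
  apply/vlineP; exists t; apply: coord_col_inj.
  by rewrite coord_colZ of_coord_colK -tE mulmxBl mul1mx coord_colB coord_col_rho.
have rhog1 : rho g <> \1%VF by rewrite -rho1 => /rho_inj gE; rewrite gE eqxx in g1.
have dimfix : (n <= (\dim (fixedSpace (rho g))).+1)%N.
  rewrite -(limg_ker_dim (rho g - \1%VF) {:V}) capfv -addn1 leq_add2l.
  apply: leq_trans (_ : \dim <[of_coord_col w]> <= 1)%N; last by rewrite dim_vline leq_b1.
  by apply/dimvS/subvP => _ /memv_imgP[v _ ->]; rewrite !lfun_simp.
have fix_lt : (\dim (fixedSpace (rho g)) < n)%N.
  rewrite ltn_neqAle dimvS ?subvf // andbT; apply: contra_notN rhog1 => dimE.
  have /fixedSpacesP fixE : ({:V} <= fixedSpace (rho g))%VS.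
    by rewrite -(eqP (_ : fixedSpace (rho g) == {:V}%VS)) // eqEdim subvf (eqP dimE) leqnn.
  by apply/lfunP => v; rewrite fixE ?memvf // id_lfunE.
split=> //.
- by apply/eqP/lker0P => x y xy; rewrite -(rhoK x) xy rhoK.
- by exists #[g]%g => [|v]; rewrite ?order_gt0 // rhoXg expg_order rho1 id_lfunE.
- by exists (fixedSpace (rho g)); rewrite ?subvv //; apply/eqP; rewrite eqn_leq fix_lt.
Qed.

Lemma evp_coord_col v P : evp (coord_col v) P = P.@[coords v].
Proof. by apply: meval_eq => a; rewrite mxE. Qed.

Lemma pact_invariant g (b : B) : pact rho_mx g (val b) = val b.
Proof.
apply: evp_ext => // x; rewrite evp_pact // -[x]of_coord_colK -coord_col_rho.
rewrite !evp_coord_col; case: b => P /= /asboolP; exact.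
Qed.

Lemma invariant_of_pact (P : A) :
  (forall g, pact rho_mx g P = P) -> exists b : B, val b = P.
Proof.
move=> Pinv; have PB : P \in invariant_poly rho.
  apply/asboolP => g v.
  by rewrite -!evp_coord_col coord_col_rho -evp_pact // Pinv.
by exists (InvariantRing PB).
Qed.

Lemma val_in_alg x : val (x%:A : B) = x%:MP.
Proof. by rewrite linearZ /= -mul_mpolyC mulr1. Qed.

Lemma invariant_ext (b b' : B) :
  (forall v, quot_map rho v b = quot_map rho v b') -> b = b'.
Proof.
move=> bb'; apply: val_inj; apply: evp_ext => // x.
by rewrite -[x]of_coord_colK !evp_coord_col; apply: bb'.
Qed.

Lemma quot_ext (p q : quot rho) : (forall b, p b = q b) -> p = q.
Proof.
case: p => f [[fD] [fM] [fZ]]; case: q => g [[gD] [gM] [gZ]] fg.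
have {fg} : f = g by apply/funext.
move=> E; subst g.
by rewrite (Prop_irrelevance fD gD) (Prop_irrelevance fM gM) (Prop_irrelevance fZ gZ).
Qed.

(** Lying over extends the character [p] to all of A; its values on the variables are the
    coordinates of [w]. *)
Lemma quot_map_surjective (p : quot rho) : exists w, quot_map rho w = p.
Proof.
pose j : {rmorphism B -> A} := val.
pose c : {rmorphism k -> B} := in_alg B.
pose chi : {rmorphism B -> k} := p.
have jsurj (P : A) : (forall g, pact rho_mx g P = P) -> exists b, j b = P.
  exact: invariant_of_pact.
have chi_c x : chi (c x) = x.
  by rewrite /chi /c /= linearZ /= rmorph1; apply: mulr1.
have [//|//|//|P _|chi' [chiD chiM chi_val]] :=
  @lying_over k B A j c chi chi_c val_inj (fun=> True).
  exact: (@integral_invariants gT A (pact rho_mx) (pact1 k_char rho_mx1)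
    (pactM k_char rho_mxM) B j val_inj jsurj P).
have chiB : zmod_morphism chi'.
  by move=> P Q; apply: (addIr (chi' Q)); rewrite -chiD // !subrK.
have chi1 : monoid_morphism chi'.
  by split=> [|P Q]; [rewrite -(rmorph1 j) chi_val rmorph1 | apply: chiM].
pose f : {rmorphism A -> k} := HB.pack chi'
  (GRing.isZmodMorphism.Build A k chi' chiB) (GRing.isMonoidMorphism.Build A k chi' chi1).
pose x : 'cV[k]_n := \col_a f 'X_a.
exists (of_coord_col x); apply: quot_ext => b.
rewrite -[RHS]/(chi b) -chi_val -[LHS]evp_coord_col of_coord_colK.
apply: (@mpoly_rmorph_ext n k _ (evp x) f) => [y|a].
  by rewrite [LHS]evpC -val_in_alg -[RHS]/(chi' (j _)) chi_val chi_c.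
by rewrite [LHS]evpX mxE.
Qed.

Lemma quot_map_rho x v : quot_map rho (rho x v) = quot_map rho v.
Proof. by apply: quot_ext => -[P PB]; move/asboolP: (PB); apply. Qed.

(** Otherwise some affine function vanishes at [w] but nowhere on the orbit of [u], and its norm is
    an invariant separating them. *)
Lemma quot_map_orbit u w : quot_map rho u = quot_map rho w -> exists x, w = rho x u.
Proof.
move=> uw; apply: contrapT => nex.
have [x|x|c cP] := @thin_avoid k 'rV[k]_n k_char _
    (fun x c => (c *m (coord_col (rho x u) - coord_col w)) 0 0 = 0).
- apply: thin_subspace => a b c d cx dx.
  rewrite mulmxDl -(scalemxAl a c) -(scalemxAl b d).
  by rewrite mxE [X in X + _]mxE [X in _ + X]mxE cx dx !mulr0 addr0.
- have : coord_col (rho x u) - coord_col w != 0.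
    rewrite subr_eq0; apply/eqP => /coord_col_inj xu.
    by apply: nex; exists x; rewrite xu.
  move/cV0Pn => [a ra]; exists (delta_mx 0 a); rewrite -rowE mxE.
  exact/eqP.
pose l : A := linear_form c - ((c *m coord_col w) 0 0)%:MP.
have [b bE] := invariant_of_pact (fun g =>
  act_orbit_norm (pactM k_char rho_mxM) g l).
have lE y : evp y l = (c *m (y - coord_col w)) 0 0.
  by rewrite rmorphB /= evp_linear_form evpC mulmxBr !mxE.
have evb v : quot_map rho v b = \prod_x (c *m (coord_col (rho x v) - coord_col w)) 0 0.
  rewrite -[LHS]evp_coord_col -[invariant_val b]/(val b) bE rmorph_prod.
  by apply: eq_bigr => x _; rewrite [LHS]evp_pact // lE coord_col_rho.
have : quot_map rho u b != 0.
  by rewrite evb; apply/prodf_neq0 => x _; apply/eqP.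
rewrite uw evb (bigD1 1%g) //= coord_col_rho rho_mx1 mul1mx subrr mulmx0 mxE.
by rewrite mul0r eqxx.
Qed.

Lemma stab_rho x v : stab rho (rho x v) = (stab rho v :^ x^-1)%g.
Proof.
have [rho1 rhoM _] := rho_faithful.
apply/setP => g; rewrite mem_conjgV !inE conjgE !rhoM !comp_lfunE.
apply/eqP/eqP => [->|E].
  by rewrite -comp_lfunE -rhoM mulVg rho1 id_lfunE.
move/(congr1 (rho x)): E.
by rewrite -[rho x (rho x^-1%g _)]comp_lfunE -rhoM mulgV rho1 id_lfunE.
Qed.

Lemma card_stab_quot u w : quot_map rho u = quot_map rho w ->
  #|stab rho u| = #|stab rho w|.
Proof. by case/quot_map_orbit => x ->; rewrite stab_rho cardJg. Qed.

(** Pullbacks are only given one function at a time; they form a homomorphism because an invariant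
    is determined by its values on the image of V. *)
Lemma pullback_exists sigma : quot_morphism sigma ->
  exists s : {rmorphism B -> B}, forall b p, sigma p b = p (s b).
Proof.
move=> sigmaP; have [s sE] := choice sigmaP.
have sEv v b : quot_map rho v (s b) = sigma (quot_map rho v) b by rewrite sE.
have sB : zmod_morphism s.
  by move=> b b'; apply: invariant_ext => v; rewrite sEv [LHS]rmorphB [RHS]rmorphB;
    congr (_ - _); apply/esym/sEv.
have s1 : monoid_morphism s.
  split=> [|b b']; apply: invariant_ext => v.
    by rewrite sEv [LHS]rmorph1 [RHS]rmorph1.
  by rewrite sEv [LHS]rmorphM [RHS]rmorphM; congr (_ * _); apply/esym/sEv.
exists (HB.pack_for {rmorphism B -> B} s (GRing.isZmodMorphism.Build B B s sB)
  (GRing.isMonoidMorphism.Build B B s s1)) => b p.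
exact: sE.
Qed.

Lemma stab_lift sigma : quot_automorphism sigma ->
  exists tau : {perm gT}, tau \in Aut [set: gT] /\
    forall v, exists w, quot_map rho w = sigma (quot_map rho v) /\
      tau @: stab rho v \subset stab rho w.
Proof.
move=> [sigmaP [sigma' [sigma'P sigmaK sigma'K]]].
have [s sE] := pullback_exists sigmaP.
have [s' s'E] := pullback_exists sigma'P.
have sK : cancel s s' by move=> b; apply: invariant_ext => v; rewrite -s'E -sE sigma'K.
have s'K : cancel s' s by move=> b; apply: invariant_ext => v; rewrite -sE -s'E sigmaK.
have s_alg x : s (in_alg B x) = in_alg B x.
  apply: invariant_ext => v; rewrite -sE /= !linearZ /=.
  by rewrite !rmorph1.
have [tau [tauM tau_inj tauP]] := @automorphism_permutes_stabilisers k n k_char gT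
  rho_mx rho_mx1 rho_mxM rho_mx_codim B val (in_alg B) val_inj pact_invariant
  invariant_of_pact val_in_alg s s' sK s'K s_alg.
exists (perm tau_inj); split.
  rewrite inE; apply/andP; split; first by apply/fintype.subsetP => x; rewrite inE.
  by apply/morphicP => x y _ _; rewrite !permE.
move=> v; have [w0 w0E] := quot_map_surjective (sigma (quot_map rho v)).
have [b|x xP] := tauP (coord_col v) (coord_col w0).
  by rewrite !evp_coord_col -[LHS]/(quot_map rho w0 b) w0E sE.
exists (rho x w0); split; first by rewrite quot_map_rho.
apply/fintype.subsetP => _ /imsetP[g + ->]; rewrite !inE permE => /eqP gv.
apply/eqP/coord_col_inj; rewrite !coord_col_rho; apply: xP.
by rewrite -coord_col_rho gv.
Qed.

Lemma luna_stratum_permuted sigma : quot_automorphism sigma ->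
  exists2 tau : {perm gT}, tau \in Aut [set: gT] &
    forall H : {group gT},
      (sigma @` luna_stratum rho H = luna_stratum rho (tau @: H))%classic.
Proof.
move=> sigmaA; have [sigmaP [sigma' [sigma'P sigmaK sigma'K]]] := sigmaA.
have sigma'A : quot_automorphism sigma' by split=> //; exists sigma.
have [tau [tauA tauP]] := stab_lift sigmaA.
have [tau' [_ tau'P]] := stab_lift sigma'A.
have tauM x y : tau (x * y)%g = (tau x * tau y)%g.
  by apply: (morphicP (Aut_morphic tauA)); rewrite inE.
have tauJ (H : {set gT}) x : (tau @: (H :^ x) = (tau @: H) :^ tau x)%g.
  have tauV : tau x^-1%g = (tau x)^-1%g.
    apply/eqP; rewrite eq_sym eq_invg_mul -tauM mulgV; apply/eqP.
    by apply: (mulgI (tau 1%g)); rewrite -tauM !mulg1.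
  rewrite /conjugate -!imset_comp; apply: eq_imset => g.
  by rewrite /= !conjgE !tauM tauV.
have lift v : exists w, quot_map rho w = sigma (quot_map rho v) /\
    tau @: stab rho v = stab rho w.
  have [w [wE sub]] := tauP v; exists w; split=> //.
  apply/eqP; rewrite eqEcard sub card_imset; last exact: perm_inj.
  (* Counting gives equality: [tau'] embeds the stabiliser of [w] into that of some [v'] over the
     same point as [v], which has the cardinality of the stabiliser of [v]. *)
  have [v' [v'E sub']] := tau'P w.
  rewrite (card_stab_quot (u := v) (w := v')); last by rewrite v'E wE sigmaK.
  by rewrite -(card_imset _ (@perm_inj _ tau')) subset_leq_card.
exists tau => // H; apply/seteqP; split=> [_ [_ [v <-] /imsetP[x _ vH] <-]|q].
  have [w [wE vw]] := lift v; exists w => //.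
  by rewrite -vw vH tauJ; apply/imsetP; exists (tau x); rewrite ?inE.
case=> w wq /imsetP[y _ wH].
have [v vE] := quot_map_surjective (sigma' q).
have [w' [w'E vw']] := lift v.
have [x xE] : exists x, w' = rho x w.
  by apply: quot_map_orbit; rewrite wq w'E vE sigma'K.
exists (quot_map rho v); last by rewrite vE sigma'K.
(* The stabiliser of [w] is tau(H) conjugated by [y], and passing to [w' = rho x w] conjugates
   further by [x^-1]; the conjugating element is pulled back through [tau]. *)
exists v => //; apply/imsetP; exists ((tau^-1)%g (y * x^-1)%g); rewrite ?inE //.
apply: (imset_inj (@perm_inj _ tau)).
by rewrite vw' xE stab_rho wH tauJ permKV conjsgM.
Qed.

End Quotient.

Theorem theorem1p1 (k : closedFieldType) (hchar : [pchar k] =i pred0)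
    (V : vectType k) (gT : finGroupType) (rho : gT -> 'End(V))
    (hrho : faithful_repr rho)
    (hrefl : forall g : gT, ~ pseudo_reflection (rho g)) :
  (forall sigma : quot rho -> quot rho, quot_automorphism sigma ->
     exists2 tau : {perm gT}, tau \in Aut [set: gT] &
       forall H : {group gT},
         (sigma @` luna_stratum rho H = luna_stratum rho (tau @: H))%classic)
  /\ luna_intrinsic rho.
Proof.
split=> [|sigma sigmaA H]; first exact: luna_stratum_permuted.
have [tau tauA tauH] := luna_stratum_permuted hchar hrho hrefl sigmaA.
exists (autm tauA @* H)%G; rewrite tauH.
suff -> : (autm tauA @* H)%G = tau @: H :> {set gT} by [].
by rewrite /= morphimEsub //; apply: finset.subsetT.
Qed.
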